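(* Let $1\le p\le\infty$. Suppose that $f,g:\mathbb{R}\to\mathbb{R}$ are locally Lipschitz, that there are nonnegative constants $k_1,k_2,c_1,c_2$ with $|g(x)|\le k_1|x|+k_2$ and $|f(x)|\le c_1|x|+c_2$ for all $x\in\mathbb{R}$, and that $k_1\beta c_1<1$. Suppose moreover that $g\in C^1(\mathbb{R})$ and that there are nonnegative constants $k_3,k_4$ with $|g'(x)|\le k_3|x|+k_4$ for all $x\in\mathbb{R}$. Then there exists a global attractor $\mathcal{A}$ for the flow $T(t)$ in $L^p(\Omega)$, and, for any $\sigma>0$, $\mathcal{A}$ is contained in the ball centered at $0$ of $L^p(\Omega)$ of radius $$R=(1+\sigma)\,\frac{(k_1\beta c_2+k_1\beta h+k_2)\,|\Omega|^{1/p}}{1-k_1\beta c_1}.$$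
   Context: $\Omega\subset\mathbb{R}^N$ ($N\ge1$) is a bounded smooth domain with Lebesgue measure $|\Omega|$ (with $|\Omega|^{1/p}=1$ if $p=\infty$); $h,\beta\ge 0$ are constants. $J:\mathbb{R}^N\times\mathbb{R}^N\to\mathbb{R}$ is a nonnegative symmetric function of class $C^1$ with $\int_{\mathbb{R}^N}J(x,y)\,dy=\int_{\mathbb{R}^N}J(x,y)\,dx=1$, and $Kv(x)=\int_{\mathbb{R}^N}J(x,y)v(y)\,dy$. The phase space is $X=\{u\in L^p(\mathbb{R}^N): u(x)=0 \text{ for } x\in\mathbb{R}^N\setminus\Omega\}$ with the norm of $L^p(\mathbb{R}^N)$, identified with $L^p(\Omega)$. The map $F:X\to X$ is $F(u)(x)=g(\beta K(f\circ u)(x)+\beta h)$ for $x\in\Omega$ and $F(u)(x)=0$ for $x\in\mathbb{R}^N\setminus\Omega$. The flow $T(t)$, $t\ge0$, on $X$ is $T(t)u_0=u(\cdot,t)$, where $u$ is the global solution of $\partial_t u=-u+F(u)$, $u(\cdot,0)=u_0$. A global attractor is a maximal invariant compact set $\mathcal{A}\subset X$ ($T(t)\mathcal{A}=\mathcal{A}$ for all $t\ge0$) which attracts each bounded set of $X$. Balls are closed balls. *)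

(* Defs.v *)
From HB Require Import structures.
From mathcomp Require Import all_boot all_order all_algebra.
From mathcomp Require Import all_classical all_reals all_analysis.
From mathcomp Require Import measurable_realfun ess_sup_inf.

Set Implicit Arguments.
Unset Strict Implicit.
Unset Printing Implicit Defensive.
Import Order.TTheory GRing.Theory Num.Theory.
Import numFieldNormedType.Exports.
Local Open Scope classical_set_scope.
Local Open Scope ring_scope.

Definition rV_display : measure_display. Proof. exact: default_measure_display. Qed.

Section measurable_rV.
Context (R : realType) (n : nat).

Let coords : 'I_n -> 'rV[R]_n -> R := fun i v => v ord0 i.

Let rV_set0 : g_sigma_preimage coords set0.
Proof. exact: sigma_algebra0. Qed.

Let rV_setC A : g_sigma_preimage coords A -> g_sigma_preimage coords (~` A).
Proof. exact: sigma_algebraC. Qed.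

Let rV_bigcup (F : _^nat) : (forall i, g_sigma_preimage coords (F i)) ->
  g_sigma_preimage coords (\bigcup_i (F i)).
Proof. exact: sigma_algebra_bigcup. Qed.

(* The product sigma-algebra, generated by the coordinates (as the library
   does for n.-tuple); it is the Borel sigma-algebra of 'rV[R]_n. *)
HB.instance Definition _ := @isMeasurable.Build rV_display
  'rV[R]_n (g_sigma_preimage coords) rV_set0 rV_setC rV_bigcup.

Lemma measurable_coord (i : 'I_n) :
  measurable_fun [set: 'rV[R]_n] (fun v : 'rV[R]_n => v ord0 i).
Proof.
move=> _ Y mY; rewrite setTI; apply: sub_sigma_algebra => /=.
rewrite -bigcup_seq/=; exists i => /=; first by rewrite mem_index_enum.
by exists Y => //; rewrite setTI.
Qed.

Lemma measurable_fun_rV d (T : measurableType d) (f : T -> 'rV[R]_n) :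
  (forall i, measurable_fun [set: T] (fun x => f x ord0 i)) ->
  measurable_fun [set: T] f.
Proof.
move=> mf _ A; rewrite setTI; move: A.
apply: smallest_sub.
  split => [|A mA|F mF].
  - by rewrite preimage_set0.
  - by rewrite setTD preimage_setC; exact: measurableC.
  - by rewrite preimage_bigcup; exact: bigcup_measurable.
move=> A; rewrite -bigcup_seq/= => -[i _ [B mB <-]].
by have := mf i measurableT B mB; rewrite !setTI.
Qed.

End measurable_rV.

Section lebesgue_rV.
Context (R : realType).

Definition rV_cons n (z : R * 'rV[R]_n) : 'rV[R]_n.+1 :=
  \row_i if unlift ord0 i is Some j then z.2 ord0 j else z.1.

Definition rV_uncons n (w : 'rV[R]_n.+1) : R * 'rV[R]_n :=
  (w ord0 ord0, \row_i w ord0 (lift ord0 i)).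

Lemma rV_cons0 n (z : R * 'rV[R]_n) : rV_cons z ord0 ord0 = z.1.
Proof. by rewrite mxE unlift_none. Qed.

Lemma rV_consS n (z : R * 'rV[R]_n) i :
  rV_cons z ord0 (lift ord0 i) = z.2 ord0 i.
Proof. by rewrite mxE liftK. Qed.

Lemma rV_consK n : cancel (@rV_cons n) (@rV_uncons n).
Proof.
case=> x v; rewrite /rV_uncons rV_cons0; congr pair.
by apply/rowP => i; rewrite mxE rV_consS.
Qed.

Lemma rV_unconsK n : cancel (@rV_uncons n) (@rV_cons n).
Proof.
move=> w; apply/rowP => i; case: (unliftP ord0 i) => [j|] ->.
  by rewrite rV_consS mxE.
by rewrite rV_cons0.
Qed.

Lemma measurable_rV_cons n : measurable_fun [set: R * 'rV[R]_n] (@rV_cons n).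
Proof.
apply: measurable_fun_rV => i; case: (unliftP ord0 i) => [j|] ->.
  under eq_fun do rewrite rV_consS.
  exact: (measurableT_comp (@measurable_coord R n j) measurable_snd).
by under eq_fun do rewrite rV_cons0; exact: measurable_fst.
Qed.

Lemma measurable_rV_uncons n :
  measurable_fun [set: 'rV[R]_n.+1] (@rV_uncons n).
Proof.
rewrite /rV_uncons; apply: measurable_fun_pair => /=; first exact: measurable_coord.
apply: measurable_fun_rV => i.
by under eq_fun do rewrite mxE; exact: measurable_coord.
Qed.

Section step.
Variables (n : nat) (mu : {sigma_finite_measure set 'rV[R]_n -> \bar R}).

Definition lebesgue_rV_step : set 'rV[R]_n.+1 -> \bar R :=
  pushforward (@lebesgue_measure R \x mu)%E (@rV_cons n).

Let step0 : lebesgue_rV_step set0 = 0%E.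
Proof. by rewrite /lebesgue_rV_step /pushforward preimage_set0 measure0. Qed.

Let step_ge0 A : (0 <= lebesgue_rV_step A)%E.
Proof. by rewrite /lebesgue_rV_step /pushforward; exact: measure_ge0. Qed.

Let step_sigma_additive : semi_sigma_additive lebesgue_rV_step.
Proof.
move=> F mF tF mUF; rewrite /lebesgue_rV_step /pushforward preimage_bigcup.
have mpre A : measurable A -> measurable (@rV_cons n @^-1` A).
  by move=> mA; rewrite -[X in measurable X]setTI; exact: measurable_rV_cons.
apply: measure_semi_sigma_additive.
- by move=> k; exact: mpre.
- apply/trivIsetP => /= i j _ _ ij; rewrite -preimage_setI.
  by move/trivIsetP : tF => /(_ _ _ _ _ ij) ->//; rewrite preimage_set0.
- by rewrite -preimage_bigcup; exact: mpre.
Qed.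

HB.instance Definition _ := isMeasure.Build _ _ _ lebesgue_rV_step
  step0 step_ge0 step_sigma_additive.

Let step_sigma_finite : sigma_finite setT lebesgue_rV_step.
Proof.
have /sigma_finiteP[F [FT ndF Foo]] := sigma_finiteT (@lebesgue_measure R).
have /sigma_finiteP[G [GT ndG Goo]] := sigma_finiteT mu.
exists (fun k => @rV_uncons n @^-1` (F k `*` G k)).
  apply/esym/seteqP; split => // w _.
  have [i _ Fi] : (\bigcup_k F k) (rV_uncons w).1 by rewrite -FT.
  have [j _ Gj] : (\bigcup_k G k) (rV_uncons w).2 by rewrite -GT.
  exists (maxn i j) => //; split.
  - by move: Fi; exact/subsetPset/ndF/leq_maxl.
  - by move: Gj; exact/subsetPset/ndG/leq_maxr.
move=> k; have [mF Fk] := Foo k; have [mG Gk] := Goo k; split.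
  rewrite -[X in measurable X]setTI; apply: measurable_rV_uncons => //.
  exact: measurableX.
rewrite /lebesgue_rV_step /pushforward -comp_preimage.
rewrite (_ : _ \o _ = id) ?preimage_id; last first.
  by apply/funext => z /=; rewrite rV_consK.
by rewrite product_measure1E// lte_mul_pinfty// ge0_fin_numE.
Qed.

HB.instance Definition _ :=
  Measure_isSigmaFinite.Build _ _ _ lebesgue_rV_step step_sigma_finite.

End step.

(* N-dimensional Lebesgue measure: the N-fold product of the Lebesgue measure
   of R, transported to row vectors; lebesgue_rV_box computes it on boxes. *)
Fixpoint lebesgue_rV (n : nat) : {sigma_finite_measure set 'rV[R]_n -> \bar R} :=
  match n with
  | 0 => dirac (0 : 'rV[R]_0)
  | m.+1 => lebesgue_rV_step (lebesgue_rV m)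
  end.

Lemma lebesgue_rV_box n (a b : 'I_n -> R) : (forall i, a i <= b i) ->
  lebesgue_rV n [set v : 'rV[R]_n | forall i, a i <= v ord0 i <= b i] =
  (\prod_(i < n) (b i - a i))%:E.
Proof.
elim: n a b => [|n IHn] a b ab.
  by rewrite big_ord0 /= diracE mem_set// => -[].
pose B := [set v : 'rV[R]_n |
  forall i : 'I_n, a (lift ord0 i) <= v ord0 i <= b (lift ord0 i)].
have mB : measurable B.
  rewrite (_ : B = \bigcap_(i in [set: 'I_n])
      [set v : 'rV[R]_n | v ord0 i \in `[a (lift ord0 i), b (lift ord0 i)]]).
    apply: fin_bigcap_measurable => // i _; rewrite -[X in measurable X]setTI.
    exact: (measurable_coord i measurableT (measurable_itv _)).
  apply/seteqP; split => v /= vab i; first by rewrite /= in_itv/= vab.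
  by have := vab i I; rewrite /= in_itv.
transitivity ((lebesgue_measure \x lebesgue_rV n)%E
    ([set` `[a ord0, b ord0]] `*` B)).
  rewrite /= /lebesgue_rV_step /pushforward; congr (product_measure1 _ _ _).
  apply/seteqP; split => -[x v] /=.
    move=> xv; split; first by have := xv ord0; rewrite rV_cons0 /= in_itv.
    by move=> i; have := xv (lift ord0 i); rewrite rV_consS.
  move=> [xab vab] i; case: (unliftP ord0 i) => [j|] ->.
    by rewrite rV_consS; exact: vab.
  by rewrite rV_cons0; move: xab; rewrite /= in_itv.
rewrite product_measure1E// IHn// big_ord_recl EFinM; congr (_ * _)%E.
apply: (etrans (lebesgue_measure_itv `[a ord0, b ord0])).
rewrite /= lte_fin; case: ltP => // ba.
by rewrite (@le_anti _ _ (a ord0) (b ord0)) ?subrr// ab.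
Qed.

End lebesgue_rV.

(* The library's LspaceType carries no algebraic structure; here L^p(mu) is
   the quotient of LfunType mu p1 by almost-everywhere equality, as a normed
   module. *)
Section Lp.
Context d (T : measurableType d) (R : realType).
Variables (mu : {measure set T -> \bar R}) (p : \bar R) (p1 : (1 <= p)%E).

Definition Lfun_aeq (f g : LfunType mu p1) : bool := `[< f = g %[ae mu] >].

Let Lfun_aeq_refl : reflexive Lfun_aeq.
Proof. by move=> f; apply/asboolP/ae_eq_refl. Qed.

Let Lfun_aeq_sym : symmetric Lfun_aeq.
Proof.
by move=> f g; apply/idP/idP => /asboolP h; apply/asboolP/ae_eq_sym.
Qed.

Let Lfun_aeq_trans : transitive Lfun_aeq.
Proof.
by move=> f g h /asboolP gf /asboolP fh; apply/asboolP/(ae_eq_trans gf fh).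
Qed.

Canonical Lfun_aeq_equiv :=
  EquivRel Lfun_aeq Lfun_aeq_refl Lfun_aeq_sym Lfun_aeq_trans.

Local Open Scope quotient_scope.

Definition Lp : Type := {eq_quot Lfun_aeq}.

HB.instance Definition _ := Choice.on Lp.
HB.instance Definition _ := EqQuotient.on Lp.

Definition Lp_repr (u : Lp) : LfunType mu p1 := repr u.
Definition Lp_fun (u : Lp) : T -> R := Lp_repr u.

Definition Lp_class (f : LfunType mu p1) : Lp := \pi_Lp f.

Lemma Lp_classP (f g : LfunType mu p1) :
  Lp_class f = Lp_class g <-> f = g %[ae mu].
Proof.
split=> [/eqP|fg]; first by rewrite eqmodE => /asboolP.
by apply/eqP; rewrite eqmodE; apply/asboolP.
Qed.

Lemma Lp_reprK (u : Lp) : Lp_class (Lp_repr u) = u.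
Proof. exact: reprK. Qed.

Lemma Lp_classK (f : LfunType mu p1) : Lp_repr (Lp_class f) = f %[ae mu].
Proof. by apply/Lp_classP; rewrite Lp_reprK. Qed.

Definition Lp_zero : Lp := Lp_class 0.
Definition Lp_opp (u : Lp) : Lp := Lp_class (- Lp_repr u).
Definition Lp_add (u v : Lp) : Lp := Lp_class (Lp_repr u + Lp_repr v).
Definition Lp_scale (a : R) (u : Lp) : Lp := Lp_class (a *: Lp_repr u).
Definition Lp_norm (u : Lp) : R := fine ('N[mu]_p[EFin \o Lp_fun u])%E.

Let Lfun_addE (f g : LfunType mu p1) x : (f + g) x = f x + g x.
Proof. by []. Qed.

Let Lfun_oppE (f : LfunType mu p1) x : (- f) x = - f x.
Proof. by []. Qed.

Let Lfun_scaleE a (f : LfunType mu p1) x : (a *: f) x = a * f x.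
Proof. by []. Qed.

Lemma Lp_addE (f g : LfunType mu p1) :
  Lp_add (Lp_class f) (Lp_class g) = Lp_class (f + g).
Proof.
apply/Lp_classP; apply: filterS2 (Lp_classK f) (Lp_classK g) => x fx gx _.
by rewrite !Lfun_addE fx// gx.
Qed.

Lemma Lp_oppE (f : LfunType mu p1) : Lp_opp (Lp_class f) = Lp_class (- f).
Proof.
apply/Lp_classP; apply: filterS (Lp_classK f) => x fx _.
by rewrite !Lfun_oppE fx.
Qed.

Lemma Lp_scaleE a (f : LfunType mu p1) :
  Lp_scale a (Lp_class f) = Lp_class (a *: f).
Proof.
apply/Lp_classP; apply: filterS (Lp_classK f) => x fx _.
by rewrite !Lfun_scaleE fx.
Qed.

Let Lp_addA : associative Lp_add.
Proof.
move=> u v w; rewrite -(Lp_reprK u) -(Lp_reprK v) -(Lp_reprK w).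
by rewrite !Lp_addE addrA.
Qed.

Let Lp_addC : commutative Lp_add.
Proof.
by move=> u v; rewrite -(Lp_reprK u) -(Lp_reprK v) !Lp_addE addrC.
Qed.

Let Lp_add0 : left_id Lp_zero Lp_add.
Proof. by move=> u; rewrite -(Lp_reprK u) Lp_addE add0r. Qed.

Let Lp_addN : left_inverse Lp_zero Lp_opp Lp_add.
Proof. by move=> u; rewrite -(Lp_reprK u) Lp_oppE Lp_addE addNr. Qed.

HB.instance Definition _ :=
  GRing.isZmodule.Build Lp Lp_addA Lp_addC Lp_add0 Lp_addN.

Lemma Lp_classD (f g : LfunType mu p1) :
  Lp_class (f + g) = Lp_class f + Lp_class g.
Proof. by rewrite -Lp_addE. Qed.

Let Lp_scaleA a b u : Lp_scale a (Lp_scale b u) = Lp_scale (a * b) u.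
Proof. by rewrite -(Lp_reprK u) !Lp_scaleE scalerA. Qed.

Let Lp_scale1 : left_id 1 Lp_scale.
Proof. by move=> u; rewrite -(Lp_reprK u) Lp_scaleE scale1r. Qed.

Let Lp_scaleDr : right_distributive Lp_scale +%R.
Proof.
move=> a u v; rewrite -(Lp_reprK u) -(Lp_reprK v).
by rewrite -Lp_classD !Lp_scaleE -Lp_classD scalerDr.
Qed.

Let Lp_scaleDl u : {morph Lp_scale^~ u : a b / a + b}.
Proof.
by move=> a b; rewrite -(Lp_reprK u) !Lp_scaleE -Lp_classD scalerDl.
Qed.

HB.instance Definition _ :=
  GRing.Zmodule_isLmodule.Build R Lp Lp_scaleA Lp_scale1 Lp_scaleDr Lp_scaleDl.

Lemma Lp_normE (f : LfunType mu p1) :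
  Lp_norm (Lp_class f) = fine ('N[mu]_p[EFin \o f])%E.
Proof.
rewrite /Lp_norm /Lp_fun; move: (Lp_repr _) (Lp_classK f) => g gf.
congr fine; rewrite unlock.
have mE (h : LfunType mu p1) : measurable_fun setT (EFin \o h).
  exact/measurable_EFinP.
case: p p1 f g gf mE => [r r1|r1|r1] f g gf mE //.
- congr (_ `^ _)%E; apply: ae_eq_integral => //.
  + apply: (measurableT_comp (measurable_poweR r)).
    exact: measurableT_comp (mE _).
  + apply: (measurableT_comp (measurable_poweR r)).
    exact: measurableT_comp (mE _).
  + by apply: filterS gf => x gfx _ /=; rewrite gfx.
- case: ifPn => // _; apply: eq_ess_sup.
  by apply: filterS gf => x gfx /=; rewrite gfx.
Qed.

Lemma Lp_norm_fin (f : LfunType mu p1) :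
  (fine ('N[mu]_p[EFin \o f]))%:E = ('N[mu]_p[EFin \o f])%E.
Proof. exact: finite_norm_fine. Qed.

Let Lp_normD u v : Lp_norm (u + v) <= Lp_norm u + Lp_norm v.
Proof.
rewrite -(Lp_reprK u) -(Lp_reprK v) -Lp_classD !Lp_normE.
exact: ler_LnormD.
Qed.

Let Lp_normZ a u : Lp_norm (a *: u) = `|a| * Lp_norm u.
Proof.
rewrite -(Lp_reprK u) [_ *: _]Lp_scaleE !Lp_normE.
by apply: EFin_inj; rewrite EFinM !Lp_norm_fin LnormZ.
Qed.

Let Lp_norm0_eq0 u : Lp_norm u = 0 -> u = 0.
Proof.
rewrite -(Lp_reprK u) Lp_normE => /fine_Lnormr_eq0 u0.
exact/Lp_classP.
Qed.

HB.instance Definition _ :=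
  Lmodule_isNormed.Build R Lp Lp_normD Lp_normZ Lp_norm0_eq0.

Lemma normr_Lp_class (f : LfunType mu p1) :
  `|Lp_class f| = fine ('N[mu]_p[EFin \o f])%E.
Proof. exact: Lp_normE. Qed.

End Lp.

(* The class of f, provided f is measurable with finite p-norm
   (and the class of 0 otherwise). *)
Definition Lp_of d (T : measurableType d) (R : realType)
    (mu : {measure set T -> \bar R}) (p : \bar R) (p1 : (1 <= p)%E)
    (f : T -> R) : Lp mu p1 :=
  Lp_class (insubd (0 : LfunType mu p1) f).

Lemma Lp_ofK d (T : measurableType d) (R : realType)
    (mu : {measure set T -> \bar R}) (p : \bar R) (p1 : (1 <= p)%E)
    (f : T -> R) :
  f \in Lfun mu p -> Lp_fun (Lp_of mu p1 f) = f %[ae mu].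
Proof.
move=> fL; have := Lp_classK (insubd (0 : LfunType mu p1) f).
by rewrite insubdK.
Qed.

Section regularity.
Context (R : realType).

(* Class C^k through iterated directional derivatives; meant for finite
   dimensional V, where it is the usual notion. *)
Fixpoint class_C (V : normedModType R) (k : nat) (f : V -> R^o) : Prop :=
  match k with
  | 0 => continuous f
  | m.+1 => (forall x, differentiable f x) /\
            (forall v, class_C m (fun x => 'd f x v))
  end.

Definition locally_lipschitz (f : R^o -> R^o) : Prop :=
  forall x : R^o, exists2 U : set R^o, nbhs x U & [lipschitz f y | y in U].

(* Near each of its boundary points, a set with smooth boundary is the
   sublevel set of a smooth function without critical point there. *)
Definition smooth_boundary N (Omega : set 'rV[R]_N) : Prop :=
  forall x, (closure Omega `&` closure (~` Omega)) x ->
  exists rho : 'rV[R]_N -> R^o,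
    [/\ forall k, class_C k rho,
        exists v, 'd rho x v != 0 &
        \forall y \near x, Omega y <-> rho y < 0].

Definition bounded_smooth_domain N (Omega : set 'rV[R]_N) : Prop :=
  [/\ Omega !=set0, open Omega, connected Omega, bounded_set Omega &
      smooth_boundary Omega].

End regularity.

Section flow.
Context (R : realType) (V : normedModType R).
Implicit Types (X A B : set V) (G : V -> V) (u : R -> V) (T : R -> V -> V).

(* u : [0, +oo[ -> X is differentiable (one-sidedly at 0) in the norm of V;
   the values of u at negative times are irrelevant. *)
Definition global_solution X G (u0 : V) u : Prop :=
  u 0 = u0 /\
  forall t, 0 <= t ->
    X (u t) /\
    (s - t)^-1 *: (u s - u t) @[s --> within [set s | 0 <= s] t^'] --> G (u t).

(* The second conjunct makes T t u0 the value at time t of _the_ global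
   solution issued from u0. *)
Definition is_flow X G T : Prop :=
  forall u0 : V, X u0 ->
    global_solution X G u0 (T^~ u0) /\
    (forall u, global_solution X G u0 u -> forall t, 0 <= t -> u t = T t u0).

Definition invariant T A : Prop := forall t, 0 <= t -> T t @` A = A.

Definition attracts T A B : Prop :=
  forall e, 0 < e ->
    \forall t \near +oo, forall v : V, B v -> exists2 a : V, A a & `|T t v - a| < e.

Definition global_attractor X T A : Prop :=
  [/\ A `<=` X, compact A, invariant T A,
      forall B, B `<=` X -> compact B -> invariant T B -> B `<=` A &
      forall B, B `<=` X -> bounded_set B -> attracts T A B].

End flow.

Section neural_field.
Context (R : realType) (N : nat) (p : \bar R) (p1 : (1 <= p)%E).
Variable Omega : set 'rV[R]_N.

Local Notation lam := (lebesgue_rV R N).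

Definition phase_space : set (Lp lam p1) :=
  [set u | {ae lam, forall x, ~ Omega x -> Lp_fun u x = 0}].

Definition Kop (J : 'rV[R]_N -> 'rV[R]_N -> R) (v : 'rV[R]_N -> R)
    (x : 'rV[R]_N) : R :=
  \int[lam]_y (J x y * v y).

Definition Fmap (J : 'rV[R]_N -> 'rV[R]_N -> R) (f g : R -> R) (beta h : R)
    (u : Lp lam p1) : Lp lam p1 :=
  Lp_of lam p1 (fun x => if x \in Omega
                         then g (beta * Kop J (f \o Lp_fun u) x + beta * h)
                         else 0).

Definition vol_root : R :=
  if p is r%:E then fine (lam Omega) `^ r^-1 else 1.

End neural_field.

Arguments phase_space {R N p} p1 Omega.
Arguments Fmap {R N p p1} Omega J f g beta h u.
Arguments vol_root {R N} p Omega.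

(* Main.v *)
Require Import Defs.
From HB Require Import structures.
From mathcomp Require Import all_boot all_order all_algebra.
From mathcomp Require Import all_classical all_reals all_analysis.
From mathcomp Require Import measurable_realfun ess_sup_inf.
From mathcomp Require Import lra ring.
Import Order.TTheory GRing.Theory Num.Theory.
Import numFieldNormedType.Exports.
Local Open Scope classical_set_scope.
Local Open Scope ring_scope.

(** Write rho = k1 beta c1 < 1 and
    C = (k1 beta c2 + k1 beta h + k2) |Omega|^(1/p). The proof separates three
    properties of the map F from the dynamics of u' = - u + F u.

    The map F smooths. For u in the phase space and x in Omega,
      K (f o u) x = f 0 + int_Omega J x y (f (u y) - f 0) dy,
    because u vanishes outside Omega and J x has mass 1 (Kop_splitE). On
    Omega x Omega the kernel is bounded and uniformly continuous, and the growth
    of f controls the L^1 norm of f o u - f 0 on Omega. Hence, for u in a ball,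
    the functions F u have a common bound and a common modulus of continuity on
    Omega; all functions with this bound and this modulus form a convex set,
    compact in L^p by the argument of Arzela and Ascoli
    (equicontinuous_set_compact, Fmap_compact). Moreover F is continuous
    (Fmap_continuous), and Jensen's inequality with Tonelli's theorem gives
    |F u| <= rho |u| + C (conv_norm_le, Fmap_norm_le).

    Consequently, along a solution, |u t| <= C / (1 - rho) + |u 0| e^(-(1-rho)t)
    (damped_norm_le), and if F (u t) remains in a convex set K then the distance
    from u t to K is at most a constant times e^(-t) (damped_dist_le). Both are
    comparison results for Dini derivatives; no L^p-valued integral occurs.

    The attractor is the set of the values at time 0 of the bounded complete
    trajectories, which is invariant by construction. Everything else comes from
    flow_limit: if t_n >= n and the v_n are bounded, then the T (t_n) v_n
    accumulate at a point of the attractor. Indeed the trajectories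
    s |-> T (t_n + s) v_n approach a compact set at each time s, hence converge
    at each s along an ultrafilter; the mean value inequality passes to the
    limit and shows that the limit solves the equation, and uniqueness of
    solutions makes it a trajectory of T. A point of an invariant set is T n b_n
    for each n, so flow_limit applied to constant sequences gives maximality;
    attraction and closedness are equally direct. The radius follows from the
    first exponential estimate along an arbitrarily long past. *)

Set Implicit Arguments.
Unset Strict Implicit.

(** * Comparison by Dini derivatives *)

(** The supremum c of the times up to which Z s <= Z 0 + e s holds equals b: the
    condition from the left makes the inequality hold at c, and the condition
    from the right carries it beyond c. One-sided conditions suit norms and
    distances, which need not be differentiable along a solution. *)
Lemma dini_nonincreasing (R : realType) (Z : R -> R) (b : R) : 0 <= b ->
  (forall t : R, 0 < t <= b -> forall e : R, 0 < e ->
     exists2 d : R, 0 < d & forall s : R, 0 <= s -> t - d < s < t -> Z t <= Z s + e) ->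
  (forall t : R, 0 <= t < b -> forall e : R, 0 < e ->
     exists2 d : R, 0 < d & forall s : R, t < s < t + d -> Z s <= Z t + e * (s - t)) ->
  Z b <= Z 0.
Proof.
move=> b0 Zl Zr.
suff H e : 0 < e -> Z b <= Z 0 + e * b.
  case: (eqVneq b 0) => [->//|bn0]; have bp : 0 < b by rewrite lt_neqAle eq_sym bn0.
  by apply/ler_addgt0Pr => e e0; have := H (e / b) (divr_gt0 e0 bp); rewrite divfK.
move=> e0.
pose S := [set t : R | 0 <= t <= b /\ forall s : R, 0 <= s <= t -> Z s <= Z 0 + e * s].
have S0 : S 0.
  split; first by rewrite lexx b0.
  by move=> s s0; have -> : s = 0 by [lra]; rewrite mulr0 addr0.
have Sb : ubound S b by move=> t [/andP[]].
have hS : has_sup S by split; [exists 0 | exists b].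
pose c := sup S.
have c0 : 0 <= c by apply: ub_le_sup => //; exists b.
have cb : c <= b by apply: ge_sup => //; exists 0.
have lec s : 0 <= s < c -> Z s <= Z 0 + e * s.
  move=> /andP[s0 sc]; have cs : 0 < c - s by rewrite subr_gt0.
  have [t St st] := sup_adherent cs hS.
  by case: St => _; apply; apply/andP; split => //; rewrite /c in st; lra.
have Zc : Z c <= Z 0 + e * c.
  case: (eqVneq c 0) => [->|cn0]; first by rewrite mulr0 addr0.
  have cp : 0 < c by rewrite lt_neqAle eq_sym cn0.
  apply/ler_addgt0Pr => r r0.
  have cpb : 0 < c <= b by rewrite cp cb.
  have [d d0 Hd] := Zl c cpb r r0.
  pose s := Num.max 0 (c - d / 2).
  have s1 : 0 <= s by rewrite le_max lexx.
  have s2 : c - d / 2 <= s by rewrite le_max lexx orbT.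
  have s3 : s < c by rewrite gt_max cp /=; lra.
  have h1 : Z c <= Z s + r by apply: Hd => //; lra.
  have h2 : Z s <= Z 0 + e * s by apply: lec; lra.
  have h3 : e * s <= e * c by rewrite ler_pM2l// ltW.
  lra.
have Sc : S c.
  split; first by rewrite c0 cb.
  move=> s /andP[s0]; rewrite le_eqVlt => /predU1P[->//|sc].
  by apply: lec; rewrite s0 sc.
have [cltb|bc] := ltP c b; last first.
  by have -> : b = c by apply/eqP; rewrite eq_le cb bc.
have c0b : 0 <= c < b by rewrite c0 cltb.
have [d d0 Hd] := Zr c c0b e e0.
pose c' := Num.min b (c + d / 2).
have cc' : c < c' by rewrite lt_min cltb /=; lra.
have c'd : c' <= c + d / 2 by rewrite ge_min lexx orbT.
have c'b : c' <= b by rewrite ge_min lexx.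
have : S c'.
  split; first by lra.
  move=> s /andP[s0 sc']; have [sc|cs] := leP s c.
    by case: Sc => _; apply; rewrite s0 sc.
  have : Z s <= Z c + e * (s - c) by apply: Hd; lra.
  move: Zc; rewrite mulrBr; lra.
move=> Sc'; have : c' <= c by apply: ub_le_sup => //; exists b.
by rewrite leNgt cc'.
Qed.

(** The function y + a e^(-lam t) solves N' = lam (y - N) and is convex, since
    a >= 0, so it lies above its tangents. Hence the positive part of the
    difference between N and this function is nonincreasing. *)
Lemma dini_decay (R : realType) (N : R -> R) (lam y a : R) :
  0 < lam -> 0 <= a -> N 0 <= y + a ->
  (forall t : R, 0 <= t -> forall e : R, 0 < e ->
     exists2 d : R, 0 < d & forall s : R, 0 <= s -> `|s - t| < d -> N t <= N s + e) ->
  (forall t : R, 0 <= t -> forall e : R, 0 < e ->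
     exists2 d : R, 0 < d & forall s : R, t < s < t + d ->
       N s <= N t + (s - t) * (lam * (y - N t)) + e * (s - t)) ->
  forall t : R, 0 <= t -> N t <= y + a * expR (- (lam * t)).
Proof.
move=> lam0 a0 N0 Nl Nr b b0.
pose y' t := y + a * expR (- (lam * t)).
pose W t := N t - y' t.
suff : Num.max (W b) 0 <= Num.max (W 0) 0.
  have -> : Num.max (W 0) 0 = 0.
    by apply/max_idPr; rewrite /W /y' mulr0 oppr0 expR0 mulr1 subr_le0.
  by rewrite ge_max lexx andbT subr_le0.
have y'r t s : t <= s -> y' t - (s - t) * (lam * (y' t - y)) <= y' s.
  move=> ts; rewrite /y'.
  have -> : - (lam * s) = - (lam * t) + - (lam * (s - t)) by ring.
  rewrite expRD; set E := expR (- (lam * t)).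
  have E0 : 0 <= a * E by rewrite mulr_ge0// expR_ge0.
  have := expR_ge1Dx (- (lam * (s - t))) => H.
  have := ler_wpM2l E0 H.
  lra.
apply: (@dini_nonincreasing R (fun t => Num.max (W t) 0)) => //.
- move=> t /andP[t0 tb] e e0.
  have e2 : 0 < e / 2 by lra.
  have [d d0 Hd] := Nl t (ltW t0) (e / 2) e2.
  pose q := lam * a + 1.
  have q0 : 0 < q by rewrite /q; have := mulr_ge0 (ltW lam0) a0; lra.
  exists (Num.min d (e / 2 / q)); first by rewrite lt_min d0 !divr_gt0.
  move=> s s0 /andP[]; rewrite ltrBlDr -ltrBlDl lt_min => /andP[sd se] st.
  have h1 : N t <= N s + e / 2.
    by apply: Hd => //; rewrite ltr0_norm; lra.
  have h2 : y' s <= y' t + e / 2.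
    have h := y'r s t (ltW st).
    have h3 : (t - s) * (lam * (y' s - y)) <= e / 2.
      have : (t - s) * q <= e / 2 by rewrite -ler_pdivlMr// ltW.
      apply: le_trans; apply: ler_wpM2l; first by rewrite subr_ge0 ltW.
      rewrite /q /y' addrAC subrr add0r.
      have : expR (- (lam * s)) <= 1.
        by rewrite -expR0 ler_expR oppr_le0 mulr_ge0// ltW.
      move=> /(ler_wpM2l (mulr_ge0 (ltW lam0) a0)); lra.
    lra.
  rewrite ge_max; apply/andP; split; last first.
    by apply: addr_ge0; [rewrite le_max lexx orbT | exact: ltW].
  by apply: (@le_trans _ _ (W s + e)); [rewrite /W; lra | rewrite lerD2r le_max lexx].
- move=> t /andP[t0 tb] e e0.
  have [d d0 Hd] := Nr t t0 e e0.
  exists (Num.min d lam^-1); first by rewrite lt_min d0 invr_gt0.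
  move=> s /andP[ts]; rewrite -ltrBlDl lt_min => /andP[sd sl].
  have h1 : N s <= N t + (s - t) * (lam * (y - N t)) + e * (s - t).
    by apply: Hd; lra.
  have h2 := y'r t s (ltW ts).
  have M0 : 0 <= Num.max (W t) 0 by rewrite le_max lexx orbT.
  have M1 : W t <= Num.max (W t) 0 by rewrite le_max lexx.
  have es : 0 <= e * (s - t) by rewrite mulr_ge0 ?subr_ge0// ltW.
  rewrite ge_max; apply/andP; split; last by rewrite addr_ge0.
  have l1 : 0 <= 1 - lam * (s - t).
    by rewrite subr_ge0 mulrC -ler_pdivlMr// mul1r ltW.
  apply: (@le_trans _ _ ((1 - lam * (s - t)) * W t + e * (s - t))).
    by rewrite /W; lra.
  rewrite lerD2r; apply: (le_trans (ler_wpM2l l1 M1)).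
  rewrite mulrBl mul1r gerBl; apply: mulr_ge0 => //.
  by rewrite mulr_ge0 ?ltW// subr_gt0.
Qed.

(** * Solutions on the half-line *)

(** A derivative in the form of a first-order expansion: it makes sense at time
    0, where only one side is available. *)
Definition forward_solution (R : realType) (V : normedModType R) (G : V -> V)
    (u : R -> V) :=
  forall t : R, 0 <= t -> forall e : R, 0 < e -> exists2 d : R, 0 < d &
    forall s : R, 0 <= s -> `|s - t| < d ->
      `|u s - u t - (s - t) *: G (u t)| <= e * `|s - t|.

Section forward_solution.
Context (R : realType) (V : normedModType R).
Implicit Types (X K : set V) (G F : V -> V) (u : R -> V).

Lemma norm_slopeB (k : R) (x y : V) : k != 0 ->
  `|y - k^-1 *: x| = `|x - k *: y| / `|k|.
Proof.
move=> k0; rewrite mulrC -normfV -normrZ scalerBr scalerA mulVf// scale1r.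
exact: distrC.
Qed.

Lemma global_solutionP X G (u0 : V) u : global_solution X G u0 u <->
  [/\ u 0 = u0, forall t, 0 <= t -> X (u t) & forward_solution G u].
Proof.
split=> [[u00 Hu]|[u00 Xu Hu]].
  split=> // [t t0|t t0 e e0]; first by have [] := Hu t t0.
  have [_ /cvgrPdist_le /(_ e e0)] := Hu t t0.
  rewrite near_withinE near_withinE => /nbhs_ballP[d /= d0 Hd].
  exists d => // s s0 std.
  have [->|st] := eqVneq s t; first by rewrite !subrr scale0r subr0 !normr0 mulr0.
  have := Hd s; rewrite /ball /= distrC => /(_ std st s0).
  have st0 : s - t != 0 by rewrite subr_eq0.
  by rewrite norm_slopeB// ler_pdivrMr ?normr_gt0.
split=> // t t0; split; first exact: Xu.
apply/cvgrPdist_le => e e0; have [d d0 Hd] := Hu t t0 e e0.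
rewrite near_withinE near_withinE; apply/nbhs_ballP; exists d => //= s.
rewrite /ball /= distrC => std st s0.
have st0 : s - t != 0 by rewrite subr_eq0.
by rewrite norm_slopeB// ler_pdivrMr ?normr_gt0// Hd.
Qed.

Lemma forward_solution_shift G u (a : R) : 0 <= a ->
  forward_solution G u -> forward_solution G (fun t => u (a + t)).
Proof.
move=> a0 Hu t t0 e e0; have [d d0 Hd] := Hu (a + t) (addr_ge0 a0 t0) e e0.
exists d => // s s0 std.
have := Hd (a + s) (addr_ge0 a0 s0).
by have -> : a + s - (a + t) = s - t; [ring | apply].
Qed.

Lemma forward_solution_continuous G u : forward_solution G u ->
  forall t : R, 0 <= t -> forall e : R, 0 < e -> exists2 d : R, 0 < d &
    forall s : R, 0 <= s -> `|s - t| < d -> `|u s - u t| <= e.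
Proof.
move=> Hu t t0 e e0; have [d d0 Hd] := Hu t t0 1 ltr01.
have g0 : 0 < 1 + `|G (u t)| by rewrite ltr_wpDr.
exists (Num.min d (e / (1 + `|G (u t)|))); first by rewrite lt_min d0 divr_gt0.
move=> s s0; rewrite lt_min => /andP[sd se].
rewrite -(subrK ((s - t) *: G (u t)) (u s - u t)).
apply: (le_trans (ler_normD _ _)); rewrite normrZ.
apply: (le_trans (lerD (Hd s s0 sd) (lexx _))).
by rewrite mul1r -{1}[`|s - t|]mulr1 -mulrDr -ler_pdivlMr// ltW.
Qed.

(** The function |u t - u 0 - t c| - M t is nonincreasing in the sense of Dini.
    The vector c is arbitrary; taking it to be a limit of velocities is what
    lets the expansion survive a passage to the limit. *)
Lemma forward_solution_mean_value G u (c : V) (M b : R) : 0 <= b ->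
  forward_solution G u ->
  (forall t : R, 0 <= t < b -> `|G (u t) - c| <= M) ->
  `|u b - u 0 - b *: c| <= M * b.
Proof.
move=> b0 Hu GM.
pose Z (t : R) := `|u t - u 0 - t *: c| - M * t.
suff : Z b <= Z 0.
  by rewrite /Z subrr scale0r subr0 normr0 mulr0 subr0 subr_le0.
have Zdiff (s t : R) : Z s - Z t <= `|u s - u t - (s - t) *: c| - M * (s - t).
  rewrite /Z.
  have -> : u s - u 0 - s *: c =
      (u t - u 0 - t *: c) + (u s - u t - (s - t) *: c).
    rewrite scalerBl opprB addrACA addKr; congr (_ - _).
    by rewrite addrC addrA subrK.
  have := ler_normD (u t - u 0 - t *: c) (u s - u t - (s - t) *: c); lra.
apply: dini_nonincreasing => //.
- move=> t /andP[t0 tb] e e0.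
  have e2 : 0 < e / 2 by lra.
  have [d d0 Hd] := forward_solution_continuous Hu (ltW t0) e2.
  pose q := `|c| + `|M| + 1.
  have q0 : 0 < q by rewrite /q ltr_wpDl// addr_ge0.
  exists (Num.min d (e / 2 / q)); first by rewrite lt_min d0 !divr_gt0.
  move=> s s0 /andP[]; rewrite ltrBlDr -ltrBlDl lt_min => /andP[sd se] st.
  rewrite addrC -lerBlDr; apply: (le_trans (Zdiff t s)).
  have h1 : `|u t - u s| <= e / 2.
    by rewrite distrC; apply: Hd => //; rewrite ltr0_norm; lra.
  have h2 : (t - s) * q <= e / 2 by rewrite -ler_pdivlMr// ltW.
  have h3 := ler_normB (u t - u s) ((t - s) *: c).
  rewrite normrZ gtr0_norm ?subr_gt0// in h3.
  have h4 : - M * (t - s) <= `|M| * (t - s).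
    apply: ler_wpM2r; first by rewrite subr_ge0 ltW.
    by rewrite -normrN ler_norm.
  move: h2; rewrite /q; nra.
- move=> t /andP[t0 tb] e e0.
  have [d d0 Hd] := Hu t t0 e e0.
  exists d => // s /andP[ts std].
  rewrite addrC -lerBlDr; apply: (le_trans (Zdiff s t)).
  have -> : u s - u t - (s - t) *: c =
     (u s - u t - (s - t) *: G (u t)) + (s - t) *: (G (u t) - c).
    by rewrite scalerBr addrA subrK.
  have st0 : 0 < s - t by rewrite subr_gt0.
  have h1 := Hd s (le_trans t0 (ltW ts)).
  have {}h1 : `|u s - u t - (s - t) *: G (u t)| <= e * (s - t).
    by have := h1; rewrite gtr0_norm//; apply; lra.
  have h2 := ler_normD (u s - u t - (s - t) *: G (u t)) ((s - t) *: (G (u t) - c)).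
  rewrite [X in _ <= _ + X]normrZ gtr0_norm// in h2.
  have h3 : (s - t) * `|G (u t) - c| <= (s - t) * M.
    by rewrite ler_pM2l// GM// t0 tb.
  lra.
Qed.

Lemma forward_solution_mean_value2 G u (c : V) (M s t : R) :
  forward_solution G u -> 0 <= s -> 0 <= t ->
  (forall r : R, 0 <= r -> `|r - t| <= `|s - t| -> `|G (u r) - c| <= M) ->
  `|u s - u t - (s - t) *: c| <= M * `|s - t|.
Proof.
move=> Hu s0 t0 GM.
have [ts|st] := leP t s.
  have ts0 : 0 <= s - t by rewrite subr_ge0.
  have := @forward_solution_mean_value _ _ c M _ ts0
    (forward_solution_shift t0 Hu).
  rewrite addr0 [t + (s - t)]addrC subrK ger0_norm//; apply=> r /andP[r0 rst].
  apply: GM; first by rewrite addr_ge0.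
  by rewrite addrAC subrr add0r !ger0_norm// ltW.
have st0 : 0 <= t - s by rewrite subr_ge0 ltW.
have := @forward_solution_mean_value _ _ c M _ st0
  (forward_solution_shift s0 Hu).
have -> : u s - u t - (s - t) *: c = - (u t - u s - (t - s) *: c).
  by rewrite opprD opprB opprK -scaleNr opprB.
rewrite addr0 [s + (t - s)]addrC subrK normrN [`|s - t|]distrC (ger0_norm st0).
apply=> r /andP[r0 rst]; apply: GM; first by rewrite addr_ge0.
by rewrite ler0_norm ?(ler0_norm (ltW _)) ?subr_lt0//; lra.
Qed.

End forward_solution.

(** * The damped equation u' = - u + F u *)
Section damped.
Context (R : realType) (V : normedModType R).
Implicit Types (X K : set V) (F : V -> V) (u : R -> V).

(** A step of length h = s - t replaces k by the convex combination
    (1 - h) k + h F (u t) and multiplies the error u t - k by 1 - h. *)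
Lemma damped_stepE F u (s t : R) (k : V) :
  u s - ((1 - (s - t)) *: k + (s - t) *: F (u t)) =
  (u s - u t - (s - t) *: (- u t + F (u t))) + (1 - (s - t)) *: (u t - k).
Proof.
move: (s - t) => h.
rewrite [in RHS]scalerBr [in RHS]addrA opprD addrA [LHS]addrAC.
congr (_ - _); rewrite scalerBl scale1r scalerDr scalerN opprD opprK.
by rewrite [RHS]addrAC !addrA !subrK.
Qed.

(** With k = 0 in damped_stepE, the norm satisfies N' <= - N + (rho N + C). *)
Lemma damped_norm_le F u (rho C : R) : rho < 1 -> 0 <= C ->
  forward_solution (fun v => - v + F v) u ->
  (forall t : R, 0 <= t -> `|F (u t)| <= rho * `|u t| + C) ->
  forall t : R, 0 <= t ->
    `|u t| <= C / (1 - rho) + `|u 0| * expR (- ((1 - rho) * t)).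
Proof.
move=> rho1 C0 Hu FC; have l0 : 0 < 1 - rho by rewrite subr_gt0.
apply: (@dini_decay R (fun t => `|u t|)) => //.
- by rewrite lerDr divr_ge0// ltW.
- move=> t t0 e e0; have [d d0 Hd] := forward_solution_continuous Hu t0 e0.
  exists d => // s s0 std; rewrite -lerBlDl.
  by rewrite (le_trans (lerB_dist _ _))// distrC Hd.
- move=> t t0 e e0; have [d d0 Hd] := Hu t t0 e e0.
  exists (Num.min d 1) => [|s /andP[ts]]; first by rewrite lt_min d0 ltr01.
  rewrite -ltrBlDl lt_min => /andP[sd s1].
  have h0 : 0 < s - t by rewrite subr_gt0.
  have H1 := Hd s (le_trans t0 (ltW ts)); rewrite gtr0_norm// in H1.
  have {}H1 := H1 sd.
  have := @damped_stepE F u s t 0; rewrite scaler0 add0r subr0 => E.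
  have -> : u s = (u s - (s - t) *: F (u t)) + (s - t) *: F (u t) by rewrite subrK.
  rewrite E; apply: (le_trans (ler_normD _ _)).
  apply: (le_trans (lerD (ler_normD _ _) (lexx _))).
  rewrite [`|_ *: u t|]normrZ [`|_ *: F _|]normrZ (gtr0_norm h0).
  rewrite ger0_norm ?subr_ge0 ?(ltW s1)//.
  have := ler_wpM2l (ltW h0) (FC t t0).
  have -> : (s - t) * ((1 - rho) * (C / (1 - rho) - `|u t|)) =
    (s - t) * (C - (1 - rho) * `|u t|).
    by rewrite mulrBr mulrCA divff ?mulr1// gt_eqF.
  lra.
Qed.

(** The convex combination of damped_stepE stays in K, so the distance D to K
    satisfies D' <= - D. The infimum that defines D need not be attained, whence
    the extra e. *)
Lemma damped_dist_le F u K (k0 : V) : K k0 ->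
  (forall x y, K x -> K y -> forall h : R, 0 <= h <= 1 ->
     K ((1 - h) *: x + h *: y)) ->
  forward_solution (fun v => - v + F v) u ->
  (forall t : R, 0 <= t -> K (F (u t))) ->
  forall t e : R, 0 <= t -> 0 < e ->
    exists2 k, K k & `|u t - k| <= `|u 0 - k0| * expR (- t) + e.
Proof.
move=> Kk0 Kconv Hu KF.
pose D (t : R) := inf [set `|u t - k| | k in K].
have hinf (t : R) : has_inf [set `|u t - k| | k in K].
  split; first by exists `|u t - k0|; exists k0.
  by exists 0 => _ [k _ <-].
have Dle (t : R) k : K k -> D t <= `|u t - k|.
  by move=> Kk; apply: ge_inf; [exact: (hinf t).2 | exists k].
have Dadh (t e : R) : 0 < e -> exists2 k, K k & `|u t - k| < D t + e.
  by move=> e0; have [_ [k Kk <-]] := inf_adherent e0 (hinf t); exists k.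
have H : forall t : R, 0 <= t -> D t <= 0 + `|u 0 - k0| * expR (- (1 * t)).
  apply: dini_decay => //.
  - by rewrite add0r Dle.
  - move=> t t0 e e0; have [d d0 Hd] := forward_solution_continuous Hu t0 e0.
    exists d => // s s0 std; apply/ler_addgt0Pr => r r0.
    have [k Kk uk] := Dadh s r r0.
    apply: (le_trans (Dle t k Kk)).
    apply: (le_trans (ler_distD (u s) _ _)).
    have := Hd s s0 std; rewrite distrC; lra.
  - move=> t t0 e e0; have [d d0 Hd] := Hu t t0 e e0.
    exists (Num.min d 1) => [|s /andP[ts]]; first by rewrite lt_min d0 ltr01.
    rewrite -ltrBlDl lt_min => /andP[sd s1].
    have h0 : 0 < s - t by rewrite subr_gt0.
    have H1 := Hd s (le_trans t0 (ltW ts)); rewrite gtr0_norm// in H1.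
    have {}H1 := H1 sd.
    apply/ler_addgt0Pr => r r0.
    have [k Kk uk] := Dadh t r r0.
    apply: (le_trans (Dle s ((1 - (s - t)) *: k + (s - t) *: F (u t)) _)).
      by apply: Kconv => //; [exact: KF | rewrite (ltW h0) ltW].
    rewrite damped_stepE; apply: (le_trans (ler_normD _ _)).
    rewrite normrZ ger0_norm ?subr_ge0 ?(ltW s1)//.
    have h1 : 0 <= 1 - (s - t) by rewrite subr_ge0 ltW.
    have h2 : 1 - (s - t) <= 1 by rewrite gerBl ltW.
    have := ler_wpM2l h1 (ltW uk).
    have := ler_wpM2r (ltW r0) h2.
    lra.
move=> t e t0 e0; have [k Kk uk] := Dadh t e e0; exists k => //.
by have := H t t0; rewrite add0r mul1r; lra.
Qed.

End damped.

(** * Attractors of damped equations *)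

(** A single ultrafilter makes any family of maps into compact sets converge
    simultaneously, however large the family: this replaces the extraction of
    diagonal subsequences. *)
Lemma compact_ultra_cvg (I : Type) (V : topologicalType) (K : set V)
    (U : set_system I) (f : I -> V) :
  UltraFilter U -> compact K -> U (f @^-1` K) ->
  exists2 x, K x & f @ U --> x.
Proof.
move=> UU; rewrite compact_ultra => Kc UK.
suff fU : UltraFilter (f @ U).
  by have [x [Kx fx]] := Kc (f @ U) fU UK; exists x.
split; first exact: fmap_proper_filter.
move=> G GF fUG; apply/seteqP; split; last exact: fUG.
move=> A GA; have [//|nA] := in_ultra_setVsetC (f @^-1` A) UU.
by have /filter_ex[y []] : G (A `&` ~` A) by apply: filterI => //; exact: fUG.
Qed.

Lemma expR_decay (R : realType) (lam B e : R) : 0 < lam -> 0 < e ->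
  exists x0 : R, forall x, x0 <= x -> B * expR (- (lam * x)) <= e.
Proof.
move=> lam0 e0; exists (B / e / lam) => x.
rewrite ler_pdivrMr// [x * _]mulrC ler_pdivrMr// => Bx.
rewrite expRN ler_pdivrMr ?expR_gt0//.
have := expR_ge1Dx (lam * x) => /(ler_wpM2l (ltW e0)).
nra.
Qed.

Definition bounded_complete_trajectory (R : realType) (V : normedModType R)
    (X : set V) (T : R -> V -> V) (phi : R -> V) :=
  [/\ forall s, X (phi s), exists M, forall s, `|phi s| <= M &
      forall s t : R, 0 <= t -> phi (s + t) = T t (phi s)].

Section attractor.
Context (R : realType) (V : normedModType R).
Variables (X : set V) (F : V -> V) (T : R -> V -> V) (rho C : R).
Hypotheses (rho0 : 0 <= rho) (rho1 : rho < 1) (C0 : 0 <= C).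
Hypothesis FC : forall u, X u -> `|F u| <= rho * `|u| + C.
Hypothesis Fcont : forall u, X u -> forall e : R, 0 < e -> exists2 d : R, 0 < d &
  forall v, X v -> `|v - u| < d -> `|F v - F u| <= e.
Hypothesis Fcompact : forall M : R, exists K : set V,
  [/\ compact K, K `<=` X,
      forall x y, K x -> K y -> forall h : R, 0 <= h <= 1 ->
        K ((1 - h) *: x + h *: y) &
      forall u, X u -> `|u| <= M -> K (F u)].
Hypothesis Tflow : is_flow X (fun u => - u + F u) T.

Local Notation G := (fun u => - u + F u).
Local Notation R0 := (C / (1 - rho)).

Let l0 : 0 < 1 - rho. Proof. by rewrite subr_gt0. Qed.

Let R0_ge0 : 0 <= R0. Proof. by rewrite divr_ge0// ltW. Qed.

Let flowP v : X v ->
  [/\ T 0 v = v, forall t : R, 0 <= t -> X (T t v) & forward_solution G (T^~ v)].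
Proof. by move=> /Tflow[/global_solutionP]. Qed.

Let flow_uniq v (u : R -> V) : X v -> u 0 = v ->
  (forall t : R, 0 <= t -> X (u t)) -> forward_solution G u ->
  forall t : R, 0 <= t -> u t = T t v.
Proof.
by move=> Xv u0 Xu Hu t t0; apply: (Tflow Xv).2 => //; exact/global_solutionP.
Qed.

Lemma flow_norm_le v : X v -> forall t : R, 0 <= t ->
  `|T t v| <= R0 + `|v| * expR (- ((1 - rho) * t)).
Proof.
move=> Xv; have [T0 XT HT] := flowP Xv.
move=> t t0; rewrite -{2}T0; apply: damped_norm_le HT _ t t0 => // s s0.
exact/FC/XT.
Qed.

Lemma flow_norm_bounded v (M t : R) : X v -> `|v| <= M -> 0 <= t ->
  `|T t v| <= R0 + M.
Proof.
move=> Xv vM t0; apply: (le_trans (flow_norm_le Xv t0)).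
rewrite lerD2l (le_trans _ vM)// ler_piMr//.
rewrite -[leRHS]expR0 ler_expR oppr_le0; apply: mulr_ge0 => //; exact: ltW.
Qed.

Definition trajectory_attractor : set V :=
  [set phi 0 | phi in bounded_complete_trajectory X T].

Local Notation Att := trajectory_attractor.

Lemma trajectory_shift phi (a : R) : bounded_complete_trajectory X T phi ->
  bounded_complete_trajectory X T (fun s => phi (s + a)).
Proof.
move=> [Xp [M pM] pT]; split=> [s||s t t0]; [exact: Xp | by exists M => s; exact: pM | ].
by rewrite /= addrAC -[RHS]pT.
Qed.

Lemma trajectory_sub phi (s : R) : bounded_complete_trajectory X T phi ->
  Att (phi s).
Proof.
move=> /(@trajectory_shift phi s) H.
by exists (fun r => phi (r + s)) => //; rewrite add0r.
Qed.

Lemma trajectory_past phi (t : R) : bounded_complete_trajectory X T phi ->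
  0 <= t -> phi 0 = T t (phi (- t)).
Proof. by move=> [_ _ pT] t0; rewrite -pT// addNr. Qed.

(** The functions phi n are the trajectories of the points vn n, observed so
    that the instants tn n become time 0. Each phi n s is close to a point of the
    compact set K by damped_dist_le, so along an ultrafilter the phi n converge
    at every time to some psi with values in K. To expand psi at a time t, the
    mean value inequality is applied to phi n with c = - psi t + F (psi t): near
    t the velocities of phi n are close to c by continuity of F at psi t, and
    the estimate does not depend on n. So psi is a solution on each half-line,
    and by uniqueness it is a complete trajectory. *)
Lemma flow_limit (tn : nat -> R) (vn : nat -> V) (M : R) :
  (forall n, X (vn n)) -> (forall n, `|vn n| <= M) -> (forall n, n%:R <= tn n) ->
  exists2 a, Att a & forall (e : R) (n0 : nat), 0 < e ->
    exists2 n, (n0 <= n)%N & `|T (tn n) (vn n) - a| < e.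
Proof.
move=> Xv vM tn_ge.
pose phi n (s : R) := T (tn n + s) (vn n).
have [K [Kc KX Kconv KF]] := Fcompact (R0 + M).
have vT n (t : R) : 0 <= t -> `|T t (vn n)| <= R0 + M.
  by move=> t0; apply: flow_norm_bounded.
have M0 : 0 <= M := le_trans (normr_ge0 _) (vM 0%N).
have KT n (t : R) : 0 <= t -> K (F (T t (vn n))).
  by move=> t0; apply: KF; [have [_ XT _] := flowP (Xv n); exact: XT | exact: vT].
pose k0 := F (T 0 (vn 0%N)).
have Kk0 : K k0 by exact: KT.
have /choice[k kP] : forall n, exists kn : R -> V, forall s, K (kn s) /\
    (0 <= tn n + s -> `|phi n s - kn s| <=
      (M + `|k0|) * expR (- (1 * (tn n + s))) + n.+1%:R^-1).
  move=> n.
  suff /choice[kn knP] : forall s : R, exists v, K v /\ (0 <= tn n + s ->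
      `|phi n s - v| <= (M + `|k0|) * expR (- (1 * (tn n + s))) + n.+1%:R^-1).
    by exists kn.
  move=> s; have [ts|ts] := leP 0 (tn n + s); last by exists k0.
  have [T0 _ HT] := flowP (Xv n).
  have n0 : 0 < n.+1%:R^-1 :> R by rewrite invr_gt0.
  have [kn Kkn knP] := damped_dist_le Kk0 Kconv HT (@KT n) ts n0.
  exists kn; split=> // _; apply: (le_trans knP); rewrite lerD2r mul1r T0.
  apply: ler_wpM2r; first exact: expR_ge0.
  by rewrite (le_trans (ler_normB _ _))// lerD2r.
have [U [UU oU]] := ultraFilterLemma (_ : ProperFilter \oo).
have UP : ProperFilter U by exact: (@ultra_proper _ _ UU).
have Uge (x : R) : U [set n | x <= tn n].
  apply: oU; exists (Num.truncn `|x|).+1 => // n /= xn.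
  apply: le_trans (tn_ge n); apply: (le_trans (ler_norm x)).
  by rewrite ltW// (lt_le_trans (truncnS_gt _))// ler_nat.
have /choice[psi psiP] : forall s : R, exists x, K x /\ k^~ s @ U --> x.
  move=> s; have [x Kx xP] := @compact_ultra_cvg nat V K U (k^~ s) UU Kc
    (filterS (fun n _ => (kP n s).1) filterT).
  by exists x.
have phipsi (s : R) : forall e : R, 0 < e ->
    U [set n | 0 <= tn n + s /\ `|phi n s - psi s| <= e].
  move=> e e0.
  have e3 : 0 < e / 3 by lra.
  have [x0 x0P] := expR_decay (M + `|k0|) ltr01 e3.
  have U1 : U [set n | n.+1%:R^-1 <= e / 3].
    apply: oU; exists (Num.truncn (e / 3)^-1) => // n /= xn.
    rewrite invf_ple ?posrE// ltW//.
    by apply: (lt_le_trans (truncnS_gt _)); rewrite ler_nat ltnS.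
  have U2 : U [set n | `|psi s - k n s| <= e / 3].
    by have /cvgrPdist_le/(_ _ e3) := (psiP s).2.
  have := [elaborate filterI (filterI U1 U2)
    (filterI (Uge (x0 - s)) (Uge (- s)))].
  apply: filterS => n [[/= h1 h2] [h3 h4]].
  have ts : 0 <= tn n + s by rewrite -lerBlDr sub0r.
  split=> //.
  have := (kP n s).2 ts; have h5 : (M + `|k0|) * expR (- (1 * (tn n + s))) <= e / 3.
    by apply: x0P; rewrite -lerBlDr.
  move=> h6; have := le_trans h6 (lerD h5 h1).
  have := ler_distD (k n s) (phi n s) (psi s).
  by move: h2 => /=; rewrite (distrC (psi s)); lra.
(* L bounds all velocities, hence is a Lipschitz constant of every phi n. *)
pose L := (1 + rho) * (R0 + M) + C + 1.
have L0 : 0 < L.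
  by rewrite /L ltr_wpDl// addr_ge0// mulr_ge0// addr_ge0.
have XT n (t : R) : 0 <= t -> X (T t (vn n)).
  by move=> t0; have [_ + _] := flowP (Xv n); exact.
have GL n (t : R) : 0 <= t -> `|G (T t (vn n)) - 0| <= L.
  move=> t0; rewrite subr0 (le_trans (ler_normD _ _))// normrN.
  have := FC (XT n t t0); have := ler_wpM2l rho0 (vT n t t0).
  by have := vT n t t0; rewrite /L; lra.
have psiX s : X (psi s) by apply: KX; exact: (psiP s).1.
have psiS (s0 : R) : forward_solution G (fun s => psi (s0 + s)).
  move=> t t0 e e0.
  have e2 : 0 < e / 2 by lra.
  have [d d0 Hd] := Fcont (psiX (s0 + t)) e2.
  pose d' := Num.min d (e / 2).
  have d'0 : 0 < d' by rewrite lt_min d0.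
  exists (d' / 2 / L); first by rewrite !divr_gt0.
  move=> s s0' st.
  set c := G (psi (s0 + t)).
  apply/ler_addgt0Pr => r r0.
  pose q := Num.min (r / 2) (d' / 4).
  have q0 : 0 < q by rewrite lt_min; apply/andP; split; lra.
  have [n [[ts h1] [tt h2]]] := [elaborate filter_ex (filterI (phipsi (s0 + s) q q0)
    (phipsi (s0 + t) q q0))].
  have [_ _ HT] := flowP (Xv n).
  (* On the interval between t and s, phi n moves by at most d' / 2, so it stays
     in the d'-neighbourhood of psi (s0 + t) where the velocity is e-close to c. *)
  have H : `|phi n (s0 + s) - phi n (s0 + t)
      - (tn n + (s0 + s) - (tn n + (s0 + t))) *: c| <=
      e * `|tn n + (s0 + s) - (tn n + (s0 + t))|.
    apply: (forward_solution_mean_value2 HT ts tt) => w w0.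
    have -> : tn n + (s0 + s) - (tn n + (s0 + t)) = s - t by ring.
    move=> wst.
    have w1 : `|T w (vn n) - phi n (s0 + t)| <= d' / 2.
      have := @forward_solution_mean_value2 _ _ _ _ 0 L w (tn n + (s0 + t)) HT w0 tt.
      rewrite scaler0 subr0 => /(_ (fun r r0 _ => GL n r r0)) w2.
      apply: (le_trans w2); rewrite mulrC -ler_pdivlMr//.
      by rewrite (le_trans wst)// ltW.
    have w2 : `|T w (vn n) - psi (s0 + t)| < d'.
      have := ler_distD (phi n (s0 + t)) (T w (vn n)) (psi (s0 + t)).
      have : q <= d' / 4 by rewrite ge_min lexx orbT.
      lra.
    move: w2; rewrite lt_min => /andP[w2 w3].
    have := Hd _ (XT n w w0) w2.
    have -> : - T w (vn n) + F (T w (vn n)) - c =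
       - (T w (vn n) - psi (s0 + t)) + (F (T w (vn n)) - F (psi (s0 + t))).
      by rewrite /c !opprD opprK addrACA.
    move=> w4; apply: (le_trans (ler_normD _ _)); rewrite normrN; lra.
  have E : tn n + (s0 + s) - (tn n + (s0 + t)) = s - t by ring.
  rewrite E in H.
  have -> : psi (s0 + s) - psi (s0 + t) - (s - t) *: c =
    (phi n (s0 + s) - phi n (s0 + t) - (s - t) *: c) +
    ((phi n (s0 + t) - psi (s0 + t)) - (phi n (s0 + s) - psi (s0 + s))).
    rewrite [RHS]addrAC; congr (_ - _).
    by rewrite opprB addrA [_ - _ + (_ - _)]addrA subrK [RHS]addrC addrA subrK.
  apply: (le_trans (ler_normD _ _)); apply: lerD => //.
  apply: (le_trans (ler_normB _ _)).
  have : q <= r / 2 by rewrite ge_min lexx.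
  lra.
exists (psi 0).
  exists psi => //; split=> //.
  - have /compact_bounded[B [_ BP]] := Kc.
    by exists (B + 1) => s; apply: BP; [rewrite ltrDl | exact: (psiP s).1].
  - move=> s t t0; apply: (@flow_uniq (psi s) (fun t => psi (s + t))) => //.
    by rewrite addr0.
move=> e n0 e0; have e2 : 0 < e / 2 by lra.
have n0U : U [set n | (n0 <= n)%N] by apply: oU; exists n0.
have [n [/= h1 [_ h2]]] := [elaborate filter_ex (filterI n0U (phipsi 0 _ e2))].
by exists n => //; rewrite /phi addr0 in h2; lra.
Qed.

(** A point of the attractor has an arbitrarily long bounded past, which removes
    the transient term of flow_norm_le. *)
Lemma trajectory_attractor_norm_le a : Att a -> `|a| <= R0.
Proof.
move=> [phi tphi <-]; have [Xp [M pM] pT] := tphi.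
apply/ler_addgt0Pr => e e0; have [x0 x0P] := expR_decay M l0 e0.
pose x := Num.max x0 0.
have xge0 : 0 <= x by rewrite le_max lexx orbT.
rewrite (trajectory_past tphi xge0).
apply: (le_trans (flow_norm_le (Xp _) xge0)); rewrite lerD2l.
apply: le_trans (x0P x _); last by rewrite le_max lexx.
by apply: ler_wpM2r; [exact: expR_ge0 | exact: pM].
Qed.

(** The long past also removes the transient term of damped_dist_le, so the
    attractor lies in the compact set K attached to the radius R0. It is closed:
    points an n of the attractor that converge to a have the form T n (bn n) with
    bn n in the attractor, and flow_limit identifies a. *)
Lemma trajectory_attractor_compact : compact Att.
Proof.
have [K [Kc KX Kconv KF]] := Fcompact R0.
have Kcl : closed K by apply: compact_closed => //; exact: norm_hausdorff.
apply: (@subclosed_compact _ Att K) => //.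
- move=> a Aa.
  have /choice[an anP] : forall n : nat, exists b : V, Att b /\ `|a - b| < n.+1%:R^-1.
    move=> n; have n0 : 0 < n.+1%:R^-1 :> R by rewrite invr_gt0.
    have [b [Ab ab]] := Aa _ (nbhsx_ballx a _ n0).
    by exists b; split=> //; move: ab; rewrite -ball_normE.
  have /choice[bn bnP] : forall n : nat, exists b : V, Att b /\ an n = T n%:R b.
    move=> n; have [phi tphi <-] := (anP n).1.
    exists (phi (- n%:R)); split; first exact: trajectory_sub.
    exact: trajectory_past.
  have AX v : Att v -> X v by move=> [phi [Xp _ _] <-].
  have [a' Aa' a'P] := @flow_limit (fun n => n%:R) bn R0
    (fun n => AX _ (bnP n).1) (fun n => trajectory_attractor_norm_le (bnP n).1)
    (fun n => lexx _).
  suff -> : a = a' by [].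
  apply/eqP; rewrite -subr_eq0 -normr_le0; apply/ler_addgt0Pr => e e0.
  rewrite add0r; have e2 : 0 < e / 2 by lra.
  have [n nP] := a'P _ (Num.truncn (e / 2)^-1) e2.
  rewrite -(bnP n).2 => an1.
  apply: (le_trans (ler_distD (an n) a a')); rewrite [leRHS]splitr.
  apply: lerD; last exact: ltW.
  apply: (le_trans (ltW (anP n).2)).
  rewrite invf_ple ?posrE// ltW//.
  by apply: (lt_le_trans (truncnS_gt _)); rewrite ler_nat ltnS.
- move=> a Aa; have [phi tphi <-] := Aa; have [Xp [M pM] pT] := tphi.
  apply: Kcl => B /nbhs_ballP[e /= e0 eB].
  have e3 : 0 < e / 3 by lra.
  pose k0 := F (phi 0).
  have FK s : K (F (phi s)).
    by apply: KF => //; apply/trajectory_attractor_norm_le/trajectory_sub.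
  have [x0 x0P] := expR_decay (M + `|k0|) ltr01 e3.
  pose x := Num.max x0 0.
  have xge0 : 0 <= x by rewrite le_max lexx orbT.
  have [T0 _ HT] := flowP (Xp (- x)).
  have KT (t : R) : 0 <= t -> K (F (T t (phi (- x)))).
    by move=> t0; rewrite -pT.
  have [k Kk kP] := damped_dist_le (FK 0) Kconv HT KT xge0 e3.
  exists k; split=> //; apply: eB; rewrite -ball_normE /=.
  rewrite (trajectory_past tphi xge0); apply: (le_lt_trans kP).
  rewrite T0; have := x0P x; rewrite le_max lexx mul1r => /(_ isT).
  have : `|phi (- x) - F (phi 0)| * expR (- x) <= (M + `|k0|) * expR (- x).
    apply: ler_wpM2r; first exact: expR_ge0.
    by rewrite (le_trans (ler_normB _ _))// lerD2r.
  lra.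
Qed.

Lemma trajectory_attractorP : global_attractor X T Att.
Proof.
have eqlim (a b : V) : (forall e : R, 0 < e -> `|a - b| < e) -> a = b.
  move=> ab; apply/eqP; rewrite -subr_eq0 -normr_le0.
  by apply/ler_addgt0Pr => e e0; rewrite add0r ltW// ab.
have M1 (M : R) : M < M + 1 by rewrite ltrDl.
split.
- by move=> _ [phi [Xp _ _] <-].
- exact: trajectory_attractor_compact.
- move=> t t0; apply/seteqP; split.
    move=> _ [_ [phi tphi <-] <-]; have [_ _ <-//] := tphi.
    exact: trajectory_sub.
  move=> _ [phi tphi <-]; exists (phi (- t)); first exact: trajectory_sub.
  by rewrite -trajectory_past.
- move=> B BX /compact_bounded[M [_ BM]] Binv b Bb.
  have /choice[bn bnP] : forall n : nat, exists b', B b' /\ T n%:R b' = b.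
    move=> n; have : (T n%:R @` B) b by rewrite Binv.
    by move=> [b' Bb' <-]; exists b'.
  have [a Aa aP] := @flow_limit (fun n => n%:R) bn (M + 1)
    (fun n => BX _ (bnP n).1) (fun n => BM (M + 1) (M1 M) _ (bnP n).1)
    (fun n => lexx _).
  rewrite (eqlim b a)// => e e0; have [n _] := aP e 0%N e0.
  by rewrite (bnP n).2.
- move=> B BX [M [_ BM]] e e0; apply: contrapT => nB.
  have /choice[z zP] : forall n : nat, exists z : R * V,
      [/\ n%:R <= z.1, B z.2 & forall a, Att a -> ~ `|T z.1 z.2 - a| < e].
    move=> n; apply: contrapT => nz; apply: nB.
    exists n%:R; split; first exact: num_real.
    move=> t nt v Bv; apply: contrapT => nv; apply: nz.
    exists (t, v); split => //=; first exact: ltW.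
    by move=> a Aa av; apply: nv; exists a.
  have [a Aa aP] := @flow_limit (fun n => (z n).1) (fun n => (z n).2) (M + 1)
    (fun n => BX _ (let: And3 _ h _ := zP n in h))
    (fun n => BM (M + 1) (M1 M) _ (let: And3 _ h _ := zP n in h))
    (fun n => let: And3 h _ _ := zP n in h).
  have [n _ na] := aP e 0%N e0.
  by have [_ _ /(_ _ Aa)] := zP n.
Qed.

End attractor.

(** * Norms of L^p classes *)

(** The tangent to the convex function t |-> t^r at m, from Young's inequality
    for the product of m^(r-1) and t. *)
Lemma powR_tangent (R : realType) (r t m : R) : 1 <= r -> 0 <= t -> 0 <= m ->
  r * (m `^ (r - 1) * t) <= t `^ r + (r - 1) * m `^ r.
Proof.
rewrite le_eqVlt => /predU1P[<- t0 m0|r1 t0 m0].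
  by rewrite subrr powRr0 !mul1r mul0r addr0 powRr1.
have r0 : 0 < r by rewrite (lt_trans ltr01).
have r10 : 0 < r - 1 by rewrite subr_gt0.
pose q := r / (r - 1).
have q0 : 0 < q by rewrite divr_gt0.
have rq : r^-1 + q^-1 = 1.
  by rewrite /q invf_div -[X in X + _]div1r -mulrDl addrC subrK divff// gt_eqF.
have := conjugate_powR t0 (powR_ge0 m (r - 1)) r0 q0 rq.
rewrite -powRrM.
have -> : (r - 1) * q = r by rewrite /q mulrC divfK// gt_eqF.
rewrite -(ler_pM2l r0) => H.
rewrite [_ `^ (r - 1) * t]mulrC; apply: (le_trans H).
rewrite mulrDr mulrCA divff ?gt_eqF// mulr1 lerD2l.
by rewrite /q invf_div mulrCA [r * _]mulrC divfK ?gt_eqF// mulrC.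
Qed.

Section Lp_tools.
Context d (T : measurableType d) (R : realType).
Variables (mu : {measure set T -> \bar R}) (p : \bar R) (p1 : (1 <= p)%E).
Implicit Types (f g : T -> R) (u v : Lp mu p1).

Lemma Lnorm_pinfty (q : \bar R) (h : T -> \bar R) : q = +oo%E ->
  'N[mu]_q[h]%E = if (0 < mu [set: T])%E then ess_sup mu (abse \o h) else 0%E.
Proof. by move=> ->; rewrite unlock. Qed.

Lemma Lnorm_mono f g : measurable_fun [set: T] f -> measurable_fun [set: T] g ->
  {ae mu, forall x, `|f x| <= `|g x|} ->
  ('N[mu]_p[EFin \o f] <= 'N[mu]_p[EFin \o g])%E.
Proof.
move=> mf mg fg; rewrite unlock; case: p p1 => [r r1|_|//].
- have r0 : 0 <= r by rewrite (le_trans ler01).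
  have mpow (h : T -> R) : measurable_fun [set: T] h ->
      measurable_fun [set: T] (fun x => `|(EFin \o h) x| `^ r)%E.
    move=> mh; apply: (measurableT_comp (measurable_poweR r)).
    by apply: measurableT_comp => //; exact/measurable_EFinP.
  apply: gt0_ler_poweR.
  + by rewrite invr_ge0.
  + by rewrite in_itv /= leey andbT; apply: integral_ge0 => x _; rewrite lee_fin powR_ge0.
  + by rewrite in_itv /= leey andbT; apply: integral_ge0 => x _; rewrite lee_fin powR_ge0.
  + apply: ae_ge0_le_integral => //.
    * by move=> x _; rewrite lee_fin powR_ge0.
    * exact: mpow.
    * by move=> x _; rewrite lee_fin powR_ge0.
    * exact: mpow.
    * apply: filterS fg => x fgx _ /=.
      by rewrite lee_fin ge0_ler_powR// ?nnegrE.
- case: ifPn => // _; apply: le_ess_sup.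
  by apply: filterS fg => x fgx /=; rewrite lee_fin.
Qed.

Lemma Lfun_dominated f g : measurable_fun [set: T] f -> g \in Lfun mu p ->
  {ae mu, forall x, `|f x| <= `|g x|} -> f \in Lfun mu p.
Proof.
move=> mf /[1!inE] /andP[/[!inE]/= mg fing] fg.
apply/andP; split; rewrite inE//=.
exact: le_lt_trans (Lnorm_mono mf mg fg) fing.
Qed.

Lemma Lp_fun_Lfun u : Lp_fun u \in Lfun mu p.
Proof. exact: (valP (Lp_repr u)). Qed.

Lemma Lp_normEFin u : `|u|%:E = ('N[mu]_p[EFin \o Lp_fun u])%E.
Proof. exact: finite_norm_fine. Qed.

Lemma Lp_norm_le u v : {ae mu, forall x, `|Lp_fun u x| <= `|Lp_fun v x|} ->
  `|u| <= `|v|.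
Proof. by move=> uv; rewrite -lee_fin !Lp_normEFin; exact: Lnorm_mono. Qed.

Lemma Lp_funD u v : Lp_fun (u + v) = (fun x => Lp_fun u x + Lp_fun v x) %[ae mu].
Proof. exact: (Lp_classK (Lp_repr u + Lp_repr v)). Qed.

Lemma Lp_funN u : Lp_fun (- u) = (fun x => - Lp_fun u x) %[ae mu].
Proof. exact: (Lp_classK (- Lp_repr u)). Qed.

Lemma Lp_funZ (a : R) u : Lp_fun (a *: u) = (fun x => a * Lp_fun u x) %[ae mu].
Proof. exact: (Lp_classK (a *: Lp_repr u)). Qed.

Lemma Lp_funB u v : Lp_fun (u - v) = (fun x => Lp_fun u x - Lp_fun v x) %[ae mu].
Proof.
apply: filterS2 (Lp_funD u (- v)) (Lp_funN v) => x -> // -> //.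
Qed.

Lemma Lp_eq u v : Lp_fun u = Lp_fun v %[ae mu] -> u = v.
Proof. by move=> uv; rewrite -(Lp_reprK u) -(Lp_reprK v); apply/Lp_classP. Qed.

Variables (D : set T).
Hypotheses (mD : measurable D) (Dfin : (mu D < +oo)%E).

Lemma indic_Lfun : \1_D \in Lfun mu p.
Proof.
rewrite inE; apply/andP; split; rewrite inE/=; first exact: measurable_indic.
rewrite /finite_norm unlock; case: p p1 => [r r1|_|//].
- have r0 : r != 0 by rewrite gt_eqF// (lt_le_trans ltr01).
  apply: poweR_lty; under eq_integral => x _.
    rewrite /= indicE (_ : `|_| `^ r = \1_D x); last first.
      by rewrite indicE; case: (x \in D); rewrite ?normr1 ?powR1// normr0 powR0.
    over.
  by rewrite integral_indic// setIT.
- case: ifPn => [_|]; last by rewrite ltry.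
  apply: (@le_lt_trans _ _ 1%E); last exact: ltry.
  apply: ess_sup_ler => x /=; rewrite lee_fin indicE.
  by case: (x \in D); rewrite ?normr1 ?normr0.
Qed.

Definition Lp_indic : Lp mu p1 := Lp_of mu p1 \1_D.

Lemma Lp_indicE : Lp_fun Lp_indic = \1_D %[ae mu].
Proof. exact: Lp_ofK indic_Lfun. Qed.

Lemma Lp_norm_le_indic u (e : R) : 0 <= e ->
  {ae mu, forall x, (D x -> `|Lp_fun u x| <= e) /\ (~ D x -> Lp_fun u x = 0)} ->
  `|u| <= e * `|Lp_indic|.
Proof.
move=> e0 ue; rewrite -[e in X in _ <= X]ger0_norm// -normrZ.
apply: Lp_norm_le.
apply: filterS3 ue Lp_indicE (Lp_funZ e Lp_indic) => x [u1 u2] H1 -> //.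
rewrite H1// indicE; have [xD|xD] := boolP (x \in D).
  by rewrite mulr1 (ger0_norm e0) u1//; exact: set_mem.
rewrite mulr0 u2 ?normr0//; by move: xD; rewrite notin_setE.
Qed.

Lemma Lp_of_norm f : f \in Lfun mu p ->
  `|Lp_of mu p1 f|%:E = ('N[mu]_p[EFin \o f])%E.
Proof. by move=> fL; rewrite /Lp_of normr_Lp_class Lp_norm_fin insubdK. Qed.

Lemma Lp_indic_norm_le :
  `|Lp_indic| <= if p is r%:E then fine (mu D) `^ r^-1 else 1.
Proof.
rewrite -lee_fin (Lp_of_norm indic_Lfun) unlock.
have De : mu D = (fine (mu D))%:E by rewrite fineK// ge0_fin_numE.
case: p p1 => [r r1|_|//].
- have r0 : r != 0 by rewrite gt_eqF// (lt_le_trans ltr01).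
  under eq_integral => x _.
    rewrite /= indicE (_ : `|_| `^ r = \1_D x); last first.
      by rewrite indicE; case: (x \in D); rewrite ?normr1 ?powR1// normr0 powR0.
    over.
  by rewrite integral_indic// setIT De.
- case: ifPn => [_|_]; last by rewrite lee_fin.
  apply: ess_sup_ler => x /=; rewrite lee_fin indicE.
  by case: (x \in D); rewrite ?normr1 ?normr0.
Qed.

Lemma Lp_fun_le_norm u : p = +oo%E -> {ae mu, forall x, `|Lp_fun u x| <= `|u|}.
Proof.
move=> py; have := Lp_normEFin u; rewrite (Lnorm_pinfty _ py).
case: ifPn => [_ uE|muT _].
  have := ess_sup_ge mu (abse \o (EFin \o Lp_fun u)).
  by rewrite -uE; apply: filterS => x /=; rewrite lee_fin.
exists setT; split => //; apply/eqP; rewrite eq_le measure_ge0 andbT.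
by rewrite leNgt.
Qed.

Lemma Lp_norm_le_cst u (c : R) : p = +oo%E -> 0 <= c ->
  {ae mu, forall x, `|Lp_fun u x| <= c} -> `|u| <= c.
Proof.
move=> py c0 uc; rewrite -lee_fin Lp_normEFin (Lnorm_pinfty _ py).
case: ifPn => [_|_]; last by rewrite lee_fin.
by apply/ess_supP; apply: filterS uc => x /=; rewrite lee_fin.
Qed.

(** By homogeneity it suffices to treat the unit ball. There |u| <= 1 almost
    everywhere if p = +oo, and otherwise |u| <= 1 + |u|^r, where |u|^r has
    integral at most 1. *)
Lemma Lp_L1_le u : (\int[mu]_(x in D) `|Lp_fun u x|%:E <=
  ((fine (mu D) + 1) * `|u|)%:E)%E.
Proof.
have De : mu D = (fine (mu D))%:E by rewrite fineK// ge0_fin_numE.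
have mabs v : measurable_fun D (fun x => `|Lp_fun v x|%:E).
  apply/measurable_EFinP; apply: measurableT_comp => //.
  exact: measurable_funTS.
have unit v : `|v| <= 1 ->
    (\int[mu]_(x in D) `|Lp_fun v x|%:E <= (fine (mu D) + 1)%:E)%E.
  move=> v1; case: (eqVneq p +oo%E) => [py|py].
    apply: (@le_trans _ _ (\int[mu]_(x in D) 1)%E).
      apply: ae_ge0_le_integral => //.
      apply: filterS (Lp_fun_le_norm v py) => x vx _.
      by rewrite lee_fin (le_trans vx).
    by rewrite integral_cst// mul1e De lee_fin lerDl.
  have [r pr] : exists r, p = r%:E by case: p p1 py => // r _ _; exists r.
  have r1 : 1 <= r by rewrite -lee_fin -pr.
  have mpow : measurable_fun [set: T] (fun x => (`|Lp_fun v x| `^ r)%:E).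
    apply/measurable_EFinP; apply: (measurableT_comp (measurable_powR r)).
    exact: measurableT_comp.
  have vr1 : (\int[mu]_x (`|Lp_fun v x| `^ r)%:E <= 1)%E.
    have rn0 : r != 0 by rewrite gt_eqF// (lt_le_trans ltr01).
    have := powR_Lnorm mu (EFin \o Lp_fun v) rn0.
    rewrite -pr -Lp_normEFin /= => <-; rewrite lee_fin.
    have p1r : 1 `^ r = 1 :> R by rewrite powR1.
    rewrite -[leRHS]p1r; apply: ge0_ler_powR; rewrite ?nnegrE//.
    by rewrite (le_trans ler01).
  apply: (@le_trans _ _ (\int[mu]_(x in D) (1 + (`|Lp_fun v x| `^ r)%:E))%E).
    apply: ge0_le_integral => //.
    - by apply: emeasurable_funD => //; exact: measurable_funTS.
    - move=> x _; rewrite -EFinD lee_fin.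
      have := @powR_tangent R r `|Lp_fun v x| 1 r1 (normr_ge0 _) ler01.
      rewrite !powR1 mul1r mulr1.
      have := powR_ge0 `|Lp_fun v x| r; have := normr_ge0 (Lp_fun v x).
      nra.
  rewrite ge0_integralD//; last exact: measurable_funTS.
  rewrite integral_cst// mul1e De EFinD leeD2l//.
  by apply: le_trans vr1; apply: ge0_subset_integral.
have [->|u0] := eqVneq u 0.
  rewrite normr0 mulr0 (ae_eq_integral (fun=> 0%E))//; first by rewrite integral0.
  have := Lp_classK (0 : LfunType mu p1).
  by apply: filterS => x + _ => /(_ I) H; rewrite /Lp_fun H normr0.
have un : 0 < `|u| by rewrite normr_gt0.
have /unit : `| `|u|^-1 *: u | <= 1.
  by rewrite normrZ normfV normr_id mulVf// gt_eqF.
rewrite (@ae_eq_integral _ _ _ _ _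
  (fun x => (`|u|^-1)%:E * `|Lp_fun u x|%:E)%E)//; last 2 first.
  by apply: emeasurable_funM.
  apply: filterS (Lp_funZ `|u|^-1 u) => x -> // _.
  by rewrite normrM -EFinM normfV normr_id.
rewrite ge0_integralZl//.
rewrite -(@lee_pmul2l _ `|u|%:E)//.
by rewrite muleA -EFinM divff ?gt_eqF// mul1e -EFinM mulrC.
Qed.

Lemma Lp_integrable u : mu.-integrable D (EFin \o Lp_fun u).
Proof.
apply/integrableP; split.
  by apply/measurable_EFinP; exact: measurable_funTS.
by apply: (le_lt_trans (Lp_L1_le u)); exact: ltry.
Qed.

End Lp_tools.

(** * Open sets of R^N and measurability *)
Section open_measurable.
Context (R : realType) (N : nat).

Lemma rV_ball_measurable (x : 'rV[R]_N) (e : R) : measurable (ball x e).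
Proof.
have [e0|e0] := ltP 0 e; last first.
  rewrite (_ : ball x e = set0)//; apply/seteqP; split => // y [].
  by rewrite ltNge e0.
rewrite (_ : ball x e = \bigcap_(i in [set: 'I_N])
    [set v : 'rV[R]_N | v ord0 i \in `]x ord0 i - e, x ord0 i + e[]).
  apply: fin_bigcap_measurable => // i _; rewrite -[X in measurable X]setTI.
  exact: (measurable_coord i measurableT (measurable_itv _)).
apply/seteqP; split => [v [_ vx] i _|v vx] /=.
  have := vx ord0 i; rewrite /ball /= in_itv /= ltr_distlC.
  by [].
split=> // i j; rewrite (ord1 i).
by have := vx j I; rewrite /ball /= in_itv /= ltr_distlC.
Qed.

Definition rat_rV (q : 'rV[rat]_N) : 'rV[R]_N := \row_i ratr (q ord0 i).

Lemma rat_rV_dense (x : 'rV[R]_N) (e : R) : 0 < e -> exists q, ball x e (rat_rV q).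
Proof.
move=> e0.
have /choice[q qP] : forall i, exists q : rat, `|x ord0 i - ratr q| < e.
  move=> i; have xe : x ord0 i - e < x ord0 i + e by lra.
  have [q] := rat_in_itvoo xe.
  by rewrite in_itv /= => qe; exists q; rewrite ltr_distlC.
exists (\row_i q i); split => // i j.
by rewrite /ball /= (ord1 i) !mxE; exact: qP.
Qed.

(** Second countability stated with balls: in R^N and in R^N x R^N these are
    boxes, which belong to the product sigma-algebra. *)
Lemma open_bigcup_ball (T : pseudoMetricType R) (Q : Type) (q : Q -> T)
    (O : set T) : (forall x e, 0 < e -> exists i, ball x e (q i)) -> open O ->
  O = \bigcup_(z in [set z : Q * nat | ball (q z.1) z.2.+1%:R^-1 `<=` O])
        ball (q z.1) z.2.+1%:R^-1.
Proof.
move=> qd oO; apply/seteqP; split => [x Ox|x [z /= zO /zO]//].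
have /nbhs_ballP[e /= e0 eO] : nbhs x O by exact: open_nbhs_nbhs.
pose n := Num.truncn (e / 2)^-1.
have n0 : 0 < n.+1%:R^-1 :> R by rewrite invr_gt0.
have ne : n.+1%:R^-1 <= e / 2.
  by rewrite invf_ple ?posrE ?divr_gt0// ltW// truncnS_gt.
have [i xi] := qd x n.+1%:R^-1 n0.
exists (i, n) => /=; last exact: ball_sym.
move=> y iy; apply: eO.
have := ball_triangle xi iy; apply: le_ball.
by rewrite [e in leRHS]splitr lerD.
Qed.

Lemma rV_open_measurable (O : set 'rV[R]_N) : open O -> measurable O.
Proof.
move=> /(open_bigcup_ball rat_rV_dense) ->; rewrite bigcup_mkcond.
apply: countable_bigcupT_measurable => [|z]; first exact: countableP.
by case: ifPn => // _; exact: rV_ball_measurable.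
Qed.

Lemma rV2_open_measurable (O : set ('rV[R]_N * 'rV[R]_N)) : open O -> measurable O.
Proof.
pose q (z : 'rV[rat]_N * 'rV[rat]_N) := (rat_rV z.1, rat_rV z.2).
have qd (x : 'rV[R]_N * 'rV[R]_N) (e : R) : 0 < e -> exists z, ball x e (q z).
  move=> e0; have [a aP] := rat_rV_dense x.1 e0.
  by have [b bP] := rat_rV_dense x.2 e0; exists (a, b).
move=> /(open_bigcup_ball qd) ->; rewrite bigcup_mkcond.
apply: countable_bigcupT_measurable => [|z]; first exact: countableP.
case: ifPn => // _.
rewrite (_ : ball _ _ = ball (q z.1).1 z.2.+1%:R^-1 `*` ball (q z.1).2 z.2.+1%:R^-1) //.
by apply: measurableX; exact: rV_ball_measurable.
Qed.

Lemma measurable_fun_ray d (T : measurableType d) (D : set T) (f : T -> R) :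
  (forall y, measurable (D `&` f @^-1` `]y, +oo[)) -> measurable_fun D f.
Proof.
move=> H; apply: (measurability _ (RGenOInfty.measurableE R)).
by move=> _ [_ [y ->] <-].
Qed.

Lemma rV_open_measurable_fun (O : set 'rV[R]_N) (f : 'rV[R]_N -> R) : open O ->
  (forall x, O x -> {for x, continuous f}) -> measurable_fun O f.
Proof.
move=> oO fc; apply: measurable_fun_ray => y; apply: rV_open_measurable.
rewrite openE => x [Ox fx]; apply: filterI; first exact: open_nbhs_nbhs.
by apply: (fc x Ox); apply: open_nbhs_nbhs; split => //; exact: interval_open.
Qed.

Lemma rV2_continuous_measurable_fun (f : 'rV[R]_N * 'rV[R]_N -> R) :
  continuous f -> measurable_fun [set: 'rV[R]_N * 'rV[R]_N] f.
Proof.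
move=> fc; apply: measurable_fun_ray => y; rewrite setTI.
apply: rV2_open_measurable; apply: open_comp; first by move=> x _; exact: fc.
exact: interval_open.
Qed.

Lemma rV_coord_le_norm (v : 'rV[R]_N) i : `|v ord0 i| <= `|v|.
Proof.
rewrite [leRHS]/Num.norm /= mx_normrE; apply/bigmax_geP; right => /=.
by exists (ord0, i).
Qed.

Lemma rV_bounded_sub_compact (O : set 'rV[R]_N) : bounded_set O ->
  exists2 K, compact K & O `<=` K.
Proof.
move=> [M [_ OM]].
exists [set v : 'rV[R]_N | forall i, v ord0 i \in `[- (`|M| + 1), `|M| + 1]].
  apply: (@rV_compact _ _ (fun=> `[- (`|M| + 1), `|M| + 1]%classic)).
  by move=> _; exact: segment_compact.
move=> v Ov i; rewrite in_itv /= -ler_norml.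
apply: (le_trans (rV_coord_le_norm v i)).
by apply: OM => //; rewrite (le_lt_trans (ler_norm M))// ltrDl.
Qed.

Lemma rV_bounded_measure_lty (O : set 'rV[R]_N) : measurable O ->
  bounded_set O -> (lebesgue_rV R N O < +oo)%E.
Proof.
move=> mO [M [_ OM]].
pose B := [set v : 'rV[R]_N | forall i, - (`|M| + 1) <= v ord0 i <= `|M| + 1].
have B0 (i : 'I_N) : - (`|M| + 1) <= `|M| + 1.
  by rewrite ge0_cp// addr_ge0.
have BE := @lebesgue_rV_box R N (fun=> - (`|M| + 1)) (fun=> `|M| + 1) B0.
apply: (@le_lt_trans _ _ (lebesgue_rV R N B)); last by rewrite BE ltry.
have mB : measurable B.
  rewrite (_ : B = \bigcap_(i in [set: 'I_N])
      [set v : 'rV[R]_N | v ord0 i \in `[- (`|M| + 1), `|M| + 1]]).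
    apply: fin_bigcap_measurable => // i _; rewrite -[X in measurable X]setTI.
    exact: (measurable_coord i measurableT (measurable_itv _)).
  apply/seteqP; split => v /= vab i; first by rewrite /= in_itv/= vab.
  by have := vab i I; rewrite /= in_itv.
apply: le_measure; rewrite ?inE// => v Ov i.
have vM : `|v| <= `|M| + 1.
  by apply: OM => //; rewrite (le_lt_trans (ler_norm M))// ltrDl.
by rewrite -ler_norml; apply: le_trans vM; exact: rV_coord_le_norm.
Qed.

End open_measurable.

(** * Compact sets of equicontinuous functions *)

(** Heine's theorem with only one of the two points in the compact set. *)
Lemma compact_uniform_continuity (R : realType) (V : normedModType R)
    (K : set V) (f : V -> R) : compact K ->
  (forall x, K x -> {for x, continuous f}) ->
  forall e : R, 0 < e -> exists2 d : R, 0 < d &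
    forall x y, K x -> `|x - y| < d -> `|f x - f y| < e.
Proof.
move=> /compact_near_coveringP Kc fc e e0.
pose P (d : R) (x : V) := forall y, `|x - y| < d -> `|f x - f y| < e.
have : \forall d \near 0^'+, K `<=` P d.
  apply: Kc => x Kx.
  have e2 : 0 < e / 2 by lra.
  have /cvgrPdist_lt/(_ _ e2)/nbhs_ballP[r /= r0 rP] := fc x Kx.
  have r2 : 0 < r / 2 by lra.
  exists (ball x (r / 2), [set d | d < r / 2]).
    by split; [exact: nbhsx_ballx | exact: nbhs_right_lt].
  move=> [x' d] /= [xx' dr] y x'y.
  have h1 : `|f x - f x'| < e / 2.
    by apply: rP; apply: le_ball xx'; lra.
  have h2 : `|f x - f y| < e / 2.
    apply: rP; rewrite -ball_normE /=.
    move: xx'; rewrite -ball_normE /=.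
    have := ler_distD x' x y; lra.
  have := ler_distD (f x) (f x') (f y); rewrite [`|f x' - f x|]distrC; lra.
move=> H.
have [d [d0 dK]] := [elaborate filter_ex (filterI (@nbhs_right_gt _ 0) H)].
by exists d => // x y Kx; exact: dK.
Qed.

Section equicontinuous_sets.
Context (R : realType) (N : nat) (p : \bar R) (p1 : (1 <= p)%E).
Variable Omega : set 'rV[R]_N.
Hypotheses (oOmega : open Omega) (bOmega : bounded_set Omega).
Local Notation lam := (lebesgue_rV R N).
Local Notation X := (phase_space p1 Omega).
Implicit Types (a b : 'rV[R]_N -> R) (m : R) (del : R -> R).

Let mOmega : measurable Omega. Proof. exact: rV_open_measurable. Qed.

Let finOmega : (lam Omega < +oo)%E.
Proof. exact: rV_bounded_measure_lty. Qed.

(** The number del e is a distance that guarantees the tolerance e. Fixing the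
    function del makes the condition convex and closed under pointwise limits. *)
Definition bounded_modulus m del a :=
  (forall x, Omega x -> `|a x| <= m) /\
  (forall e : R, 0 < e -> forall x y, Omega x -> Omega y -> `|x - y| < del e ->
     `|a x - a y| <= e).

Definition extend0 a : Lp lam p1 := Lp_of lam p1 (a \_ Omega).

Lemma bounded_modulus_measurable m del a :
  (forall e, 0 < e -> 0 < del e) -> bounded_modulus m del a ->
  measurable_fun Omega a.
Proof.
move=> del0 [_ am]; apply: rV_open_measurable_fun => // x Ox.
apply/(@cvgrPdist_le _ _ _ (nbhs x) (nbhs_filter x)) => e e0.
have H1 : nbhs x Omega by exact: open_nbhs_nbhs.
have H2 : nbhs x (ball x (del e)) by apply: nbhsx_ballx; exact: del0.
apply: filterS (filterI H1 H2) => y [Oy xy]; apply: am => //.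
by move: xy; rewrite -ball_normE.
Qed.

Lemma restrict_Lfun (m : R) a : measurable_fun Omega a ->
  (forall x, Omega x -> `|a x| <= m) -> a \_ Omega \in Lfun lam p.
Proof.
move=> ma am; apply: (Lfun_dominated p1 _ (Lp_fun_Lfun (m *: Lp_indic lam p1 Omega))).
  exact/(measurable_restrictT _ mOmega).
apply: filterS2 (Lp_funZ m (Lp_indic lam p1 Omega))
  (Lp_indicE p1 mOmega finOmega) => x -> // -> //.
rewrite /patch indicE; case: ifPn => xO; last by rewrite normr0.
rewrite mulr1; apply: (le_trans (am _ (set_mem xO))); exact: ler_norm.
Qed.

Lemma extend0E a : a \_ Omega \in Lfun lam p ->
  Lp_fun (extend0 a) = a \_ Omega %[ae lam].
Proof. exact: Lp_ofK. Qed.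

Lemma extend0_phase_space a : a \_ Omega \in Lfun lam p -> X (extend0 a).
Proof.
move=> /extend0E; apply: filterS => x -> // nOx.
by rewrite /patch memNset.
Qed.

Lemma extend0_dist a b (e : R) : 0 <= e -> a \_ Omega \in Lfun lam p ->
  b \_ Omega \in Lfun lam p -> (forall x, Omega x -> `|a x - b x| <= e) ->
  `|extend0 a - extend0 b| <= e * `|Lp_indic lam p1 Omega|.
Proof.
move=> e0 La Lb ab; apply: Lp_norm_le_indic => //.
apply: filterS3 (Lp_funB (extend0 a) (extend0 b)) (extend0E La) (extend0E Lb).
move=> x -> // -> // -> //; rewrite /patch.
by split=> Ox; [rewrite mem_set// ab | rewrite memNset// subrr].
Qed.

Definition equicontinuous_set m del : set (Lp lam p1) :=
  extend0 @` bounded_modulus m del.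

Section fixed_modulus.
Variables (m : R) (del : R -> R).
Hypotheses (m0 : 0 <= m) (del0 : forall e, 0 < e -> 0 < del e).

Lemma bounded_modulus_Lfun a : bounded_modulus m del a ->
  a \_ Omega \in Lfun lam p.
Proof.
move=> am; apply: (restrict_Lfun (m := m)) am.1.
exact: bounded_modulus_measurable am.
Qed.

Lemma equicontinuous_set_sub : equicontinuous_set m del `<=` X.
Proof. by move=> _ [a am <-]; exact/extend0_phase_space/bounded_modulus_Lfun. Qed.

Lemma equicontinuous_set_convex u v : equicontinuous_set m del u ->
  equicontinuous_set m del v -> forall h : R, 0 <= h <= 1 ->
  equicontinuous_set m del ((1 - h) *: u + h *: v).
Proof.
move=> [a am <-] [b bm <-] h /andP[h0 h1].
have h1' : 0 <= 1 - h by rewrite subr_ge0.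
have conv (x y r : R) : `|x| <= r -> `|y| <= r -> `|(1 - h) * x + h * y| <= r.
  move=> xr yr; apply: (le_trans (ler_normD _ _)).
  rewrite !normrM (ger0_norm h0) (ger0_norm h1').
  have := ler_wpM2l h1' xr; have := ler_wpM2l h0 yr; lra.
have abm : bounded_modulus m del (fun x => (1 - h) * a x + h * b x).
  split=> [x Ox|e e0 x y Ox Oy xy]; first by apply: conv; [exact: am.1|exact: bm.1].
  have -> : (1 - h) * a x + h * b x - ((1 - h) * a y + h * b y) =
    (1 - h) * (a x - a y) + h * (b x - b y) by ring.
  by apply: conv; [exact: am.2|exact: bm.2].
exists (fun x => (1 - h) * a x + h * b x) => //.
apply: Lp_eq; apply: ae_eq_trans (extend0E (bounded_modulus_Lfun abm)) _.
have H1 := [elaborate filterI (Lp_funD ((1 - h) *: extend0 a) (h *: extend0 b))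
  (filterI (Lp_funZ (1 - h) (extend0 a)) (Lp_funZ h (extend0 b)))].
have H2 := [elaborate filterI (extend0E (bounded_modulus_Lfun am))
  (extend0E (bounded_modulus_Lfun bm))].
apply: filterS2 H1 H2 => x [-> // [-> // -> //]] [-> // -> //] _.
by rewrite /patch; case: ifPn => // _; rewrite !mulr0 addr0.
Qed.

(** Along an ultrafilter the functions a k converge at every point of Omega, to a
    function l with the same bound and modulus. Equicontinuity and a compact set
    around Omega make the convergence uniform on Omega, which has finite measure,
    so it also holds in L^p. *)
Lemma equicontinuous_set_compact : compact (equicontinuous_set m del).
Proof.
rewrite compact_ultra => U UU UK.
have UP : ProperFilter U by exact: (@ultra_proper _ _ UU).
have /choice[a aP] : forall k : Lp lam p1, exists a, bounded_modulus m del a /\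
    (equicontinuous_set m del k -> k = extend0 a).
  move=> k; have [[a am <-]|nk] := pselect (equicontinuous_set m del k).
    by exists a.
  exists (fun=> 0); split => //; split => [x _|e e0 x y _ _ _].
    by rewrite normr0.
  by rewrite subrr normr0 ltW.
have am k := (aP k).1.
have /choice[l lP] : forall x, exists l : R,
    Omega x -> `|l| <= m /\ (fun k => a k x) @ U --> l.
  move=> x; have [Ox|nOx] := pselect (Omega x); last by exists 0.
  have Ua : U ((fun k => a k x) @^-1` `[-m, m]%classic).
    by apply: filterE => k; rewrite /= in_itv /= -ler_norml; exact: (am k).1.
  have [l] := compact_ultra_cvg UU (@segment_compact R (- m) m) Ua.
  by rewrite /= in_itv /= -ler_norml => lm al; exists l.
have lim x (e : R) : Omega x -> 0 < e -> U [set k | `|l x - a k x| <= e].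
  by move=> Ox e0; have /cvgrPdist_le/(_ _ e0) := (lP x Ox).2.
have lm : bounded_modulus m del l.
  split=> [x Ox|e e0 x y Ox Oy xy]; first by have [] := lP x Ox.
  apply/ler_addgt0Pr => r r0; have r2 : 0 < r / 2 by lra.
  have [k [/= k1 k2]] := [elaborate filter_ex (filterI (lim x _ Ox r2) (lim y _ Oy r2))].
  have := (am k).2 e e0 x y Ox Oy xy.
  have := ler_distD (a k x) (l x) (l y).
  have := ler_distD (a k y) (a k x) (l y).
  rewrite [`|a k y - l y|]distrC; lra.
exists (extend0 l); split; first by exists l.
have unif (e : R) : 0 < e ->
    U [set k | forall x, Omega x -> `|a k x - l x| <= e].
  move=> e0; have e3 : 0 < e / 3 by lra.
  have [K /compact_near_coveringP Kc OK] := rV_bounded_sub_compact bOmega.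
  have : \forall k \near U, K `<=` [set x | Omega x -> `|a k x - l x| <= e].
    apply: Kc => x Kx.
    have d2 : 0 < del (e / 3) / 2 by rewrite divr_gt0// del0.
    (* Points of K far from Omega have a neighbourhood on which there is nothing
       to prove; the others are compared with a point y of Omega. *)
    have [[y [Oy xy]]|nO] := pselect (Omega `&` ball x (del (e / 3) / 2) !=set0);
      last first.
      exists (ball x (del (e / 3) / 2), setT).
        by split; [exact: nbhsx_ballx | exact: filterT].
      by move=> [x' k] /= [xx' _] Ox'; exfalso; apply: nO; exists x'.
    exists (ball x (del (e / 3) / 2), [set k | `|l y - a k y| <= e / 3]).
      by split; [exact: nbhsx_ballx | exact: lim].
    move=> [x' k] /= [xx' ky] Ox'.
    have x'y : `|x' - y| < del (e / 3).
      move: xx' xy; rewrite -!ball_normE /=.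
      have := ler_distD x x' y; rewrite [`|x' - x|]distrC; lra.
    have h1 := (am k).2 _ e3 x' y Ox' Oy x'y.
    have h2 := lm.2 _ e3 x' y Ox' Oy x'y.
    have := ler_distD (a k y) (a k x') (l x').
    have := ler_distD (l y) (a k y) (l x').
    rewrite [`|a k y - l y|]distrC [`|l y - l x'|]distrC; lra.
  apply: filterS => k kO x Ox; apply: kO => //; exact: OK.
move=> B /nbhs_ballP[e /= e0 eB].
pose c := `|Lp_indic lam p1 Omega| + 1.
have c0 : 0 < c by rewrite ltr_wpDl.
have ec : 0 < e / c / 2 by rewrite !divr_gt0.
apply: filterS (filterI UK (unif _ ec)) => k [Kk kP].
apply: eB; rewrite -ball_normE /= distrC ((aP k).2 Kk).
apply: le_lt_trans (extend0_dist (ltW ec) (bounded_modulus_Lfun (am k))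
  (bounded_modulus_Lfun lm) kP) _.
apply: (@le_lt_trans _ _ (e / c / 2 * c)).
  by apply: ler_wpM2l; [exact: ltW | rewrite lerDl].
by rewrite mulrAC divfK ?gt_eqF//; lra.
Qed.

End fixed_modulus.

End equicontinuous_sets.

(** * Integration against the kernel *)
Lemma integrable_ae_eq (R : realType) d (T : measurableType d)
    (mu : {measure set T -> \bar R}) (D : set T) (f g : T -> \bar R) :
  measurable D -> measurable_fun D g -> ae_eq mu D f g ->
  mu.-integrable D f -> mu.-integrable D g.
Proof.
move=> mD mg fg /integrableP[mf foo]; apply/integrableP; split=> //.
rewrite (@ae_eq_integral _ _ _ _ _ (abse \o f))//; last 3 first.
- exact: measurableT_comp.
- exact: measurableT_comp.
- by apply: filterS fg => x fgx Dx /=; rewrite fgx.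
Qed.

Lemma weighted_integral (R : realType) d (T : measurableType d)
    (mu : {measure set T -> \bar R}) (D : set T) (j q : T -> R) (B : R) :
  measurable D -> measurable_fun D j -> (forall y, D y -> `|j y| <= B) ->
  mu.-integrable D (EFin \o q) ->
  mu.-integrable D (EFin \o (fun y => j y * q y)) /\
  `|\int[mu]_(y in D) (j y * q y)| <= B * \int[mu]_(y in D) `|q y|.
Proof.
move=> mD mj jB iq.
have inq : mu.-integrable D (EFin \o (fun y => `|q y|)) by exact: integrable_norm.
have iBq : mu.-integrable D (EFin \o (fun y => B * `|q y|)).
  by rewrite (_ : _ \o _ = (fun y => B%:E * `|q y|%:E)%E)//; exact: integrableZl.
have jq y : D y -> `|j y * q y| <= B * `|q y|.
  by move=> Dy; rewrite normrM ler_wpM2r// jB.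
have ijq : mu.-integrable D (EFin \o (fun y => j y * q y)).
  apply: le_integrable iBq => //.
    apply/measurable_EFinP; apply: measurable_funM => //.
    exact/measurable_EFinP/(measurable_int mu).
  move=> y Dy /=; rewrite lee_fin (le_trans (jq y Dy))//; exact: ler_norm.
split=> //; rewrite -RintegralZl//.
apply: (le_trans (le_normr_Rintegral mD ijq)); apply: le_Rintegral => //.
exact: integrable_norm.
Qed.

Section kernel.
Context (R : realType) (N : nat).
Variable Omega : set 'rV[R]_N.
Hypotheses (oOmega : open Omega) (bOmega : bounded_set Omega).
Local Notation lam := (lebesgue_rV R N).
Variable J : 'rV[R]_N -> 'rV[R]_N -> R.
Hypotheses (J_ge0 : forall x y, 0 <= J x y)
  (J_cont : continuous (fun z : 'rV[R]_N * 'rV[R]_N => J z.1 z.2))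
  (J_int : forall x, (\int[lam]_y (J x y)%:E = 1)%E).

Let mOmega : measurable Omega. Proof. exact: rV_open_measurable. Qed.

Lemma kernel_measurable2 :
  measurable_fun [set: 'rV[R]_N * 'rV[R]_N] (fun z => J z.1 z.2).
Proof. exact: rV2_continuous_measurable_fun. Qed.

Lemma kernel_measurable x : measurable_fun [set: 'rV[R]_N] (J x).
Proof. exact: (measurable_fun_pair2 x kernel_measurable2). Qed.

Lemma kernel_integrable x : lam.-integrable setT (EFin \o J x).
Proof.
apply/integrableP; split; first by apply/measurable_EFinP; apply: kernel_measurable.
rewrite (eq_integral (fun y => (J x y)%:E)); first by rewrite J_int ltry.
by move=> y _ /=; rewrite ger0_norm.
Qed.

Lemma kernel_bounded : exists2 B, 0 <= B &
  forall x y, Omega x -> Omega y -> `|J x y| <= B.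
Proof.
have [K Kc OK] := rV_bounded_sub_compact bOmega.
have KKc := compact_setX Kc Kc.
have /compact_bounded[B [_ BP]] := continuous_compact
  (continuous_subspaceT J_cont) KKc.
exists (`|B| + 1); first by rewrite addr_ge0.
move=> x y Ox Oy; apply: BP; first by rewrite (le_lt_trans (ler_norm B))// ltrDl.
by exists (x, y) => //; split; exact: OK.
Qed.

Lemma kernel_equicontinuous (e : R) : 0 < e -> exists2 d : R, 0 < d &
  forall x x' y, Omega x -> Omega x' -> Omega y -> `|x - x'| < d ->
    `|J x y - J x' y| <= e.
Proof.
move=> e0; have [K Kc OK] := rV_bounded_sub_compact bOmega.
have [d d0 dP] := compact_uniform_continuity (compact_setX Kc Kc)
  (fun z _ => @J_cont z) e0.
exists d => // x x' y Ox Ox' Oy xx'; apply/ltW/(dP (x, y) (x', y)).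
  by split; exact: OK.
by rewrite prod_normE /= subrr normr0 gt_max xx'.
Qed.

Definition conv (q : 'rV[R]_N -> R) (x : 'rV[R]_N) : R :=
  \int[lam]_(y in Omega) (J x y * q y).

Implicit Types q w : 'rV[R]_N -> R.

Lemma kernelM_integrable q x : lam.-integrable Omega (EFin \o q) -> Omega x ->
  lam.-integrable Omega (EFin \o (fun y => J x y * q y)).
Proof.
move=> iq Ox; have [B B0 JB] := kernel_bounded.
have mJ : measurable_fun Omega (J x) by apply: measurable_funTS; exact: kernel_measurable.
by have [] := weighted_integral mOmega mJ (fun y => JB x y Ox) iq.
Qed.

Lemma conv_le (B : R) q x : (forall x y, Omega x -> Omega y -> `|J x y| <= B) ->
  lam.-integrable Omega (EFin \o q) -> Omega x ->
  `|conv q x| <= B * \int[lam]_(y in Omega) `|q y|.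
Proof.
move=> JB iq Ox.
have mJ : measurable_fun Omega (J x) by apply: measurable_funTS; exact: kernel_measurable.
by have [] := weighted_integral mOmega mJ (fun y => JB x y Ox) iq.
Qed.

Lemma conv_distl (e : R) q x x' : lam.-integrable Omega (EFin \o q) ->
  Omega x -> Omega x' -> (forall y, Omega y -> `|J x y - J x' y| <= e) ->
  `|conv q x - conv q x'| <= e * \int[lam]_(y in Omega) `|q y|.
Proof.
move=> iq Ox Ox' JJ.
have mJ : measurable_fun Omega (fun y => J x y - J x' y).
  by apply: measurable_funTS; apply: measurable_funB; exact: kernel_measurable.
have [_] := weighted_integral mOmega mJ JJ iq.
rewrite /conv -RintegralB//; [|exact: kernelM_integrable..].
by under eq_Rintegral do rewrite mulrBl.
Qed.

Lemma conv_distr (B : R) q q' x :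
  (forall x y, Omega x -> Omega y -> `|J x y| <= B) ->
  lam.-integrable Omega (EFin \o q) -> lam.-integrable Omega (EFin \o q') ->
  Omega x ->
  `|conv q x - conv q' x| <= B * \int[lam]_(y in Omega) `|q y - q' y|.
Proof.
move=> JB iq iq' Ox.
have iqq' : lam.-integrable Omega (EFin \o (fun y => q y - q' y)).
  by rewrite (_ : _ \o _ = (fun y => (q y)%:E - (q' y)%:E)%E)//; exact: integrableB.
have := conv_le JB iqq' Ox; rewrite /conv.
under eq_Rintegral do rewrite mulrBr.
by rewrite RintegralB//; exact: kernelM_integrable.
Qed.

(** The function w = f o u is constant outside Omega but in general not zero, so
    it need not be integrable. Since J x has mass 1, subtracting that constant
    reduces the integral to Omega, where J x is bounded. *)
Lemma Kop_splitE (c : R) w x : measurable_fun [set: 'rV[R]_N] w ->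
  lam.-integrable Omega (EFin \o (fun y => w y - c)) ->
  {ae lam, forall y, ~ Omega y -> w y = c} -> Omega x ->
  Kop J w x = c + conv (fun y => w y - c) x.
Proof.
move=> mw iw wc Ox.
have mJw : measurable_fun [set: 'rV[R]_N] (fun y => J x y * (w y - c)).
  apply: measurable_funM; first exact: kernel_measurable.
  exact: measurable_funB.
have iJq := kernelM_integrable iw Ox.
have ae0 : ae_eq lam setT (EFin \o ((fun y => J x y * (w y - c)) \_ Omega))
    (EFin \o (fun y => J x y * (w y - c))).
  apply: filterS wc => y yc _ /=; rewrite /patch; case: ifPn => // yO.
  by rewrite yc ?subrr ?mulr0//; move: yO; rewrite notin_setE.
have iJq0 : lam.-integrable setT (EFin \o ((fun y => J x y * (w y - c)) \_ Omega)).
  have := (integrable_mkcond (EFin \o (fun y => J x y * (w y - c))) mOmega).1 iJq.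
  by rewrite restrict_EFin.
have iJqT : lam.-integrable setT (EFin \o (fun y => J x y * (w y - c))).
  by apply: integrable_ae_eq ae0 iJq0 => //; exact/measurable_EFinP.
have iJc : lam.-integrable setT (EFin \o (fun y => c * J x y)).
  rewrite (_ : _ \o _ = (fun y => c%:E * (J x y)%:E)%E)//.
  by apply: integrableZl => //; exact: kernel_integrable.
transitivity (\int[lam]_y (c * J x y + J x y * (w y - c))).
  by rewrite /Kop; apply: eq_Rintegral => y _; ring.
rewrite RintegralD// RintegralZl//; last exact: kernel_integrable.
congr (_ + _).
  by rewrite /Rintegral J_int mulr1.
rewrite /conv [RHS]Rintegral_mkcond; congr fine.
apply/esym/ae_eq_integral => //.
- apply/measurable_EFinP; apply/(measurable_restrictT _ mOmega).
  exact: measurable_funTS.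
- exact/measurable_EFinP.
Qed.

End kernel.

(** * The kernel in L^p *)
Section kernel_Lp.
Context (R : realType) (N : nat) (p : \bar R) (p1 : (1 <= p)%E).
Variable Omega : set 'rV[R]_N.
Hypotheses (oOmega : open Omega) (bOmega : bounded_set Omega).
Local Notation lam := (lebesgue_rV R N).
Variable J : 'rV[R]_N -> 'rV[R]_N -> R.
Hypotheses (J_ge0 : forall x y, 0 <= J x y)
  (J_cont : continuous (fun z : 'rV[R]_N * 'rV[R]_N => J z.1 z.2))
  (J_int_l : forall x, (\int[lam]_y (J x y)%:E = 1)%E)
  (J_int_r : forall y, (\int[lam]_x (J x y)%:E = 1)%E).

Let mOmega : measurable Omega. Proof. exact: rV_open_measurable. Qed.

Let finOmega : (lam Omega < +oo)%E.
Proof. exact: rV_bounded_measure_lty. Qed.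

Local Notation conv := (conv Omega J).

Lemma conv_restrict_Lfun q : lam.-integrable Omega (EFin \o q) ->
  (conv q) \_ Omega \in Lfun lam p.
Proof.
move=> iq; have [B B0 JB] := kernel_bounded bOmega J_cont.
pose I := \int[lam]_(y in Omega) `|q y|.
have I0 : 0 <= I by exact: Rintegral_ge0.
have /choice[dJ dJP] : forall e : R, exists d : R, 0 < e -> 0 < d /\
    forall x x' y, Omega x -> Omega x' -> Omega y -> `|x - x'| < d ->
      `|J x y - J x' y| <= e.
  move=> e; have [e0|e0] := ltP 0 e; last by exists 0 => // /lt_geF; rewrite e0.
  by have [d d0 dP] := kernel_equicontinuous bOmega J_cont e0; exists d.
have e0I (e : R) : 0 < e -> 0 < e / (I + 1).
  by move=> e0; rewrite divr_gt0// ltr_wpDl.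
apply: (@bounded_modulus_Lfun _ _ _ p1 _ oOmega bOmega (B * I)
  (fun e => dJ (e / (I + 1)))).
  by move=> e e0; have [] := dJP _ (e0I _ e0).
split=> [x Ox|e e0 x x' Ox Ox' xx']; first exact: conv_le.
have [_ dP] := dJP _ (e0I _ e0).
have := conv_distl oOmega bOmega J_cont iq Ox Ox' (fun y Oy => dP x x' y Ox Ox' Oy xx').
move=> /le_trans; apply; rewrite -/I mulrAC ler_pdivrMr ?ltr_wpDl//.
by rewrite ler_pM2l// lerDl.
Qed.

(** Jensen's inequality for the measure J x y dy on Omega, of mass at most 1:
    integrate the tangent inequality at the mean m. *)
Lemma conv_jensen (q : 'rV[R]_N -> R) (r : R) x : 1 <= r ->
  measurable_fun [set: 'rV[R]_N] q -> lam.-integrable Omega (EFin \o q) ->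
  (forall y, 0 <= q y) -> Omega x ->
  (((conv q x) `^ r)%:E <= \int[lam]_(y in Omega) (J x y * q y `^ r)%:E)%E.
Proof.
move=> r1 mq iq q0 Ox.
set m := conv q x; set I := (X in (_ <= X)%E).
have m0 : 0 <= m by apply: Rintegral_ge0 => y _; exact: mulr_ge0.
have r0 : 0 < r by rewrite (lt_le_trans ltr01).
have iJq := kernelM_integrable oOmega bOmega J_cont iq Ox.
have mJ : measurable_fun Omega (J x).
  by apply: measurable_funTS; exact: kernel_measurable.
have mqr : measurable_fun Omega (fun y => q y `^ r).
  apply: (measurableT_comp (measurable_powR r)); exact: measurable_funTS.
have I0 : (0 <= I)%E.
  by apply: integral_ge0 => y _; rewrite lee_fin mulr_ge0// powR_ge0.
have mE : (m%:E = \int[lam]_(y in Omega) (J x y * q y)%:E)%E.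
  by rewrite /m /Defs.Kop /conv /Rintegral fineK// integrable_fin_num.
have key : ((r * m `^ r)%:E <= I + ((r - 1) * m `^ r)%:E)%E.
  have -> : r * m `^ r = (r * m `^ (r - 1)) * m.
    by rewrite -mulrA [_ * m]mulrC mulr_powRB1.
  rewrite EFinM mE.
  rewrite -ge0_integralZl//; last 3 first.
  - by apply/measurable_EFinP; apply: measurable_funM => //; exact: measurable_funTS.
  - by move=> y _; rewrite lee_fin mulr_ge0.
  - by rewrite lee_fin mulr_ge0 ?powR_ge0// ltW.
  apply: (@le_trans _ _ (\int[lam]_(y in Omega)
     ((J x y * q y `^ r)%:E + ((r - 1) * m `^ r)%:E * (J x y)%:E))%E).
    apply: ge0_le_integral => //.
    - move=> y _; rewrite -EFinM lee_fin !mulr_ge0 ?powR_ge0//; exact: ltW.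
    - apply/measurable_EFinP; apply: measurable_funM => //.
      by apply: measurable_funM => //; exact: measurable_funTS.
    - apply: emeasurable_funD; last by apply: emeasurable_funM => //; exact/measurable_EFinP.
      by apply/measurable_EFinP; exact: measurable_funM.
    - move=> y _; rewrite -!EFinM -EFinD lee_fin.
      have := ler_wpM2l (J_ge0 x y) (powR_tangent r1 (q0 y) m0).
      by lra.
  rewrite ge0_integralD//; last 4 first.
  - by move=> y _; rewrite lee_fin mulr_ge0// powR_ge0.
  - by apply/measurable_EFinP; exact: measurable_funM.
  - by move=> y _; rewrite -EFinM lee_fin !mulr_ge0 ?powR_ge0 ?subr_ge0.
  - by apply: emeasurable_funM => //; exact/measurable_EFinP.
  rewrite leeD2l// ge0_integralZl//; last 3 first.
  - exact/measurable_EFinP.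
  - by move=> y _; rewrite lee_fin.
  - by rewrite lee_fin mulr_ge0 ?powR_ge0 ?subr_ge0.
  rewrite -[leRHS]mule1; apply: lee_wpmul2l.
    by rewrite lee_fin mulr_ge0 ?powR_ge0 ?subr_ge0.
  rewrite -(J_int_l x); apply: ge0_subset_integral => //.
  - by apply/measurable_EFinP; exact: kernel_measurable.
  - by move=> y _; rewrite lee_fin.
move: I0 key; case: I => [i| |//]; last by move=> _ _; rewrite leey.
by rewrite !lee_fin => _; lra.
Qed.

(** Schur's test: Jensen's inequality uses the mass of J x, and after Tonelli's
    theorem the mass of J in its first variable appears. The constant 1 is what
    makes the radius depend on k1 beta c1 alone. *)
Lemma conv_norm_le (u : Lp lam p1) :
  `|extend0 p1 Omega (conv (fun y => `|Lp_fun u y|))| <= `|u|.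
Proof.
pose q y := `|Lp_fun u y|.
have mq : measurable_fun [set: 'rV[R]_N] q by exact: measurableT_comp.
have q0 y : 0 <= q y by exact: normr_ge0.
have iq : lam.-integrable Omega (EFin \o q).
  by apply: integrable_norm => //; exact: Lp_integrable.
have Lq := conv_restrict_Lfun iq.
set v := extend0 _ _ _.
have vE : Lp_fun v = (conv q) \_ Omega %[ae lam] := extend0E p1 Lq.
have conv0 x : 0 <= conv q x by apply: Rintegral_ge0 => y _; exact: mulr_ge0.
have [py|py] := eqVneq p +oo%E.
  apply: Lp_norm_le_cst => //; apply: filterS vE => x -> //.
  rewrite /patch; case: ifPn => [/set_mem Ox|_]; last by rewrite normr0.
  rewrite ger0_norm//.
  have iJq := kernelM_integrable oOmega bOmega J_cont iq Ox.
  have mJ : measurable_fun Omega (J x).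
    by apply: measurable_funTS; exact: kernel_measurable.
  have cE : ((conv q x)%:E = \int[lam]_(y in Omega) (J x y * q y)%:E)%E.
    by rewrite /Rintegral fineK// integrable_fin_num.
  rewrite -lee_fin cE.
  apply: (@le_trans _ _ (\int[lam]_(y in Omega) (`|u|%:E * (J x y)%:E))%E).
    apply: ae_ge0_le_integral => //.
    - by move=> y _; rewrite lee_fin mulr_ge0.
    - apply/measurable_EFinP; apply: measurable_funM => //; exact: measurable_funTS.
    - by move=> y _; rewrite -EFinM lee_fin mulr_ge0.
    - by apply: emeasurable_funM => //; exact/measurable_EFinP.
    - apply: filterS (Lp_fun_le_norm u py) => y uy _.
      by rewrite -EFinM lee_fin mulrC ler_wpM2r.
  rewrite ge0_integralZl//; last 2 first.
  - exact/measurable_EFinP.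
  - by move=> y _; rewrite lee_fin.
  rewrite -[leRHS]mule1; apply: lee_wpmul2l; first by rewrite lee_fin.
  rewrite -(J_int_l x); apply: ge0_subset_integral => //.
  - by apply/measurable_EFinP; exact: kernel_measurable.
  - by move=> y _; rewrite lee_fin.
have [r pr] : exists r, p = r%:E by case: p p1 py => // r _ _; exists r.
have r1 : 1 <= r by rewrite -lee_fin -pr.
have r0 : 0 < r by rewrite (lt_le_trans ltr01).
have rn0 : r != 0 by rewrite gt_eqF.
have normE (w : Lp lam p1) : ((`|w| `^ r)%:E = \int[lam]_x (`|Lp_fun w x| `^ r)%:E)%E.
  by have := powR_Lnorm lam (EFin \o Lp_fun w) rn0; rewrite -pr -Lp_normEFin.
have mqr : measurable_fun [set: 'rV[R]_N] (fun y => q y `^ r).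
  exact: (measurableT_comp (measurable_powR r)).
have mJq2 : measurable_fun [set: 'rV[R]_N * 'rV[R]_N]
    (fun z => (J z.1 z.2 * q z.2 `^ r)%:E).
  apply/measurable_EFinP; apply: measurable_funM; first exact: kernel_measurable2.
  exact: (measurableT_comp mqr measurable_snd).
have mJq x : measurable_fun [set: 'rV[R]_N] (fun y => (J x y * q y `^ r)%:E).
  apply/measurable_EFinP; apply: measurable_funM => //; exact: kernel_measurable.
have J0q x y : (0 <= (J x y * q y `^ r)%:E)%E by rewrite lee_fin mulr_ge0// powR_ge0.
have le_pow : `|v| `^ r <= `|u| `^ r.
  rewrite -lee_fin !normE.
  apply: (@le_trans _ _ (\int[lam]_x \int[lam]_y (J x y * q y `^ r)%:E)%E).
    apply: ae_ge0_le_integral => //.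
    - apply/measurable_EFinP/(measurableT_comp (measurable_powR r)).
      exact: measurableT_comp.
    - by move=> x _; exact: integral_ge0.
    - exact: (@measurable_fun_fubini_tonelli_F _ _ _ _ _ lam
        (fun z => (J z.1 z.2 * q z.2 `^ r)%:E)).
    - apply: filterS vE => x -> // _; rewrite /patch; case: ifPn => [/set_mem Ox|_].
        rewrite ger0_norm//; apply: (le_trans (conv_jensen r1 mq iq q0 Ox)).
        by apply: ge0_subset_integral.
      by rewrite normr0 powR0//; exact: integral_ge0.
  rewrite (@fubini_tonelli _ _ _ _ _ lam lam
    (fun z => (J z.1 z.2 * q z.2 `^ r)%:E))//=.
  apply: ge0_le_integral => //.
  - by move=> y _; exact: integral_ge0.
  - exact: (@measurable_fun_fubini_tonelli_G _ _ _ _ _ lam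
        (fun z => (J z.1 z.2 * q z.2 `^ r)%:E)).
  - exact/measurable_EFinP.
  - move=> y _.
    under eq_integral => x _ do rewrite mulrC EFinM.
    rewrite ge0_integralZl ?J_int_r ?mule1//.
    + apply/measurable_EFinP.
      exact: (measurable_fun_pair1 y (kernel_measurable2 J_cont)).
    + by move=> x _; rewrite lee_fin.
    + by rewrite lee_fin powR_ge0.
rewrite -[leLHS]powRr1// -[leRHS]powRr1// -(mulfV rn0) !powRrM.
by apply: ge0_ler_powR => //; rewrite ?invr_ge0 ?nnegrE ?powR_ge0// ltW.
Qed.

End kernel_Lp.

(** * Functions of linear growth *)
Definition tail (R : realType) (n : nat) (s : R) : R :=
  if n%:R < `|s| then `|s| else 0.

Lemma tail_ge0 (R : realType) n (s : R) : 0 <= tail n s.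
Proof. by rewrite /tail; case: ifP. Qed.

Lemma tail_le (R : realType) n (s : R) : tail n s <= `|s|.
Proof. by rewrite /tail; case: ifP. Qed.

Section integrable_lemmas.
Context (R : realType) d (T : measurableType d).
Variables (mu : {measure set T -> \bar R}) (D : set T).
Hypotheses (mD : measurable D) (Dfin : (mu D < +oo)%E).

Lemma integrable_cst_lty (c : R) : mu.-integrable D (EFin \o cst c).
Proof.
apply/integrableP; split; first exact/measurable_EFinP/measurable_cst.
rewrite (eq_integral (cst `|c|%:E))// integral_cst//.
by apply: lte_mul_pinfty => //; rewrite lee_fin.
Qed.

Lemma measurable_tail n (q : T -> R) : measurable_fun D q ->
  measurable_fun D (fun y => tail n (q y)).
Proof.
move=> mq; rewrite /tail; apply: measurable_fun_if => //.
- apply: measurable_fun_ltr => //; exact: measurableT_comp.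
- apply: measurable_funS (measurableT_comp _ mq) => //; exact: subIsetl.
Qed.

Lemma integrable_tail n (q : T -> R) : mu.-integrable D (EFin \o q) ->
  mu.-integrable D (EFin \o (fun y => tail n (q y))).
Proof.
move=> iq.
have mq : measurable_fun D q by exact/measurable_EFinP/(measurable_int mu).
apply: (le_integrable mD) iq => //.
  by apply/measurable_EFinP; exact: measurable_tail.
by move=> y Dy /=; rewrite lee_fin ger0_norm ?tail_le ?tail_ge0.
Qed.

Lemma integral_tail_small (q : T -> R) (e : R) : mu.-integrable D (EFin \o q) ->
  0 < e -> exists n : nat, \int[mu]_(y in D) tail n.+1 (q y) <= e.
Proof.
move=> iq e0.
have mq : measurable_fun D q by exact/measurable_EFinP/(measurable_int mu).
have cvg0 : {ae mu, forall y, D y ->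
    (fun n => (tail n.+1 (q y))%:E) @ \oo --> (0%E : \bar R)}.
  apply: aeW => y Dy; apply: cvg_near_cst.
  exists (Num.truncn `|q y|) => // n /= qn; rewrite /tail ltNge ltW//.
  by apply: (lt_le_trans (truncnS_gt _)); rewrite ler_nat ltnS.
have bnd : {ae mu, forall y n, D y -> (`|(tail n.+1 (q y))%:E| <= `|(q y)%:E|)%E}.
  by apply: aeW => y n Dy; rewrite /= lee_fin ger0_norm ?tail_le ?tail_ge0.
have mt n : measurable_fun D (fun y => (tail n.+1 (q y))%:E).
  by apply/measurable_EFinP; exact: measurable_tail.
have [_ _] := dominated_convergence mD mt (measurable_cst _) cvg0
  (integrable_abse iq) bnd.
rewrite integral0 => /fine_cvgP[_ /cvgrPdist_le/(_ _ e0)[n _ /(_ n (leqnn n))]].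
rewrite /= sub0r normrN => H; exists n.
by rewrite (le_trans (ler_norm _)).
Qed.

End integrable_lemmas.

(** A substitute for a Lipschitz bound, with an error that depends on s only. If
    |s| <= n + 1, either t is close to s and f is uniformly continuous near
    [-(n+1), n+1], or |t - s| is bounded below and a multiple of it exceeds the
    growth bound. If |s| > n + 1, the tail absorbs the growth bound. *)
Lemma linear_growth_modulus (R : realType) (f : R -> R) (c1 c2 : R) (n : nat)
    (e : R) : 0 <= c1 -> 0 <= c2 -> continuous f ->
  (forall x, `|f x| <= c1 * `|x| + c2) -> 0 < e ->
  exists2 C : R, 0 <= C & forall s t,
    `|f t - f s| <= e + C * `|t - s| + 2 * (c1 + c2) * tail n.+1 s.
Proof.
move=> c10 c20 fc fb e0.
have [r r0 rP] := @compact_uniform_continuity R R^o `[- n.+1%:R, n.+1%:R]%classic f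
  (@segment_compact _ _ _) (fun x _ => fc x) e e0.
pose D := 2 * c1 * n.+1%:R + 2 * c2.
have n0 : 0 <= n.+1%:R :> R by [].
have D0 : 0 <= D by rewrite addr_ge0// !mulr_ge0.
have Dr0 : 0 <= D / r by rewrite divr_ge0// ltW.
exists (c1 + D / r); first by rewrite addr_ge0.
move=> s t.
have fts : `|f t - f s| <= c1 * `|t - s| + 2 * c1 * `|s| + 2 * c2.
  have h1 := ler_normB (f t) (f s).
  have h2 : `|t| <= `|t - s| + `|s| by rewrite -[t in `|t|](subrK s) ler_normD.
  have := ler_wpM2l c10 h2; have := fb s; have := fb t; lra.
have ts0 : 0 <= D / r * `|t - s| by rewrite mulr_ge0.
rewrite /tail; case: ifPn => [sn|]; last first.
  rewrite -leNgt => sn; rewrite mulr0 addr0.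
  have [st|st] := ltP `|s - t| r.
    have sI : `[- n.+1%:R, n.+1%:R]%classic s by rewrite /= in_itv /= -ler_norml.
    have := rP s t sI st; rewrite distrC.
    have : 0 <= c1 * `|t - s| by rewrite mulr_ge0.
    by rewrite mulrDl; lra.
  have h1 : D <= D / r * `|t - s|.
    rewrite -mulrA ler_peMr// mulrC ler_pdivlMr// mul1r distrC//.
  have h2 := ler_wpM2l c10 sn.
  by rewrite mulrDl; move: h1 h2 fts; rewrite {1}/D; lra.
have s1 : 1 <= `|s| by rewrite (le_trans _ (ltW sn))// ler1n.
have := ler_wpM2l c20 s1; rewrite mulr1 mulrDl => h; lra.
Qed.

(** * The map F *)
Section field_map.
Context (R : realType) (N : nat) (p : \bar R) (p1 : (1 <= p)%E).
Variable Omega : set 'rV[R]_N.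
Hypotheses (oOmega : open Omega) (bOmega : bounded_set Omega).
Local Notation lam := (lebesgue_rV R N).
Local Notation X := (phase_space p1 Omega).
Variable J : 'rV[R]_N -> 'rV[R]_N -> R.
Hypotheses (J_ge0 : forall x y, 0 <= J x y)
  (J_cont : continuous (fun z : 'rV[R]_N * 'rV[R]_N => J z.1 z.2))
  (J_int_l : forall x, (\int[lam]_y (J x y)%:E = 1)%E)
  (J_int_r : forall y, (\int[lam]_x (J x y)%:E = 1)%E).
Variables (beta h k1 k2 c1 c2 : R) (f g : R -> R).
Hypotheses (beta_ge0 : 0 <= beta) (h_ge0 : 0 <= h).
Hypotheses (k1_ge0 : 0 <= k1) (k2_ge0 : 0 <= k2) (c1_ge0 : 0 <= c1)
  (c2_ge0 : 0 <= c2).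
Hypotheses (f_cont : continuous f) (g_cont : continuous g).
Hypotheses (g_growth : forall x, `|g x| <= k1 * `|x| + k2)
  (f_growth : forall x, `|f x| <= c1 * `|x| + c2).

Let mOmega : measurable Omega. Proof. exact: rV_open_measurable. Qed.

Let finOmega : (lam Omega < +oo)%E.
Proof. exact: rV_bounded_measure_lty. Qed.

Local Notation conv := (conv Omega J).
Local Notation F := (Fmap Omega J f g beta h).
Local Notation vol := (fine (lam Omega)).
Implicit Types u v : Lp lam p1.

Let vol_ge0 : 0 <= vol. Proof. exact: fine_ge0. Qed.

(* By FmapE below, F u = g (field u) on Omega. *)
Let incr u (y : 'rV[R]_N) : R := f (Lp_fun u y) - f 0.

Let field u (x : 'rV[R]_N) : R := beta * (f 0 + conv (incr u) x) + beta * h.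

Let mfu u : measurable_fun [set: 'rV[R]_N] (fun y => f (Lp_fun u y)).
Proof. exact: (measurableT_comp (continuous_measurable_fun f_cont)). Qed.

Let iu u : lam.-integrable Omega (EFin \o Lp_fun u).
Proof. exact: Lp_integrable. Qed.

Let inu u : lam.-integrable Omega (EFin \o (fun y => `|Lp_fun u y|)).
Proof. exact: integrable_norm. Qed.

Let ilin u (a b : R) :
  lam.-integrable Omega (EFin \o (fun y => a * `|Lp_fun u y| + b)).
Proof.
rewrite (_ : _ \o _ = (fun y => a%:E * `|Lp_fun u y|%:E + b%:E)%E)//.
apply: integrableD => //; last exact: integrable_cst_lty.
by apply: integrableZl => //; exact: inu.
Qed.

Let linE u (a b : R) : \int[lam]_(y in Omega) (a * `|Lp_fun u y| + b) =
  a * \int[lam]_(y in Omega) `|Lp_fun u y| + b * vol.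
Proof.
rewrite RintegralD//; last 2 first.
- rewrite (_ : _ \o _ = (fun y => a%:E * `|Lp_fun u y|%:E)%E)//.
  by apply: integrableZl => //; exact: inu.
- exact: integrable_cst_lty.
by rewrite RintegralZl ?Rintegral_cst//; exact: inu.
Qed.

Let iaff u (w : 'rV[R]_N -> R) (a b : R) : measurable_fun Omega w ->
  (forall y, `|w y| <= a * `|Lp_fun u y| + b) ->
  lam.-integrable Omega (EFin \o w).
Proof.
move=> mw wab; apply: (le_integrable mOmega) (ilin u a b).
  exact/measurable_EFinP.
by move=> y Oy; rewrite /= lee_fin (le_trans (wab y))//; exact: ler_norm.
Qed.

Let iaff_le u (w : 'rV[R]_N -> R) (a b : R) : measurable_fun Omega w ->
  (forall y, `|w y| <= a * `|Lp_fun u y| + b) ->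
  \int[lam]_(y in Omega) `|w y| <=
    a * \int[lam]_(y in Omega) `|Lp_fun u y| + b * vol.
Proof.
move=> mw wab; rewrite -linE; apply: le_Rintegral => //.
by apply: integrable_norm => //; exact: iaff wab.
Qed.

Let L1_le u : \int[lam]_(y in Omega) `|Lp_fun u y| <= (vol + 1) * `|u|.
Proof.
rewrite -lee_fin /Rintegral fineK; first exact: Lp_L1_le.
by apply: integrable_fin_num => //; exact: inu.
Qed.

Let mincr u : measurable_fun Omega (incr u).
Proof. by apply: measurable_funTS; exact: measurable_funB. Qed.

Let incr_le u y : `|incr u y| <= c1 * `|Lp_fun u y| + (c2 + `|f 0|).
Proof.
by have := ler_normB (f (Lp_fun u y)) (f 0); have := f_growth (Lp_fun u y);
  rewrite /incr; lra.
Qed.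

Let iincr u : lam.-integrable Omega (EFin \o incr u).
Proof. exact: iaff (incr_le u). Qed.

Lemma FmapE u : X u -> F u = extend0 p1 Omega (fun x => g (field u x)).
Proof.
move=> Xu; congr Lp_of; apply/funext => x; rewrite /patch.
case: ifPn => // /set_mem Ox; congr (g (_ * _ + _)).
apply: (Kop_splitE oOmega bOmega J_ge0 J_cont J_int_l (mfu u) (iincr u) _ Ox).
by apply: filterS Xu => y + nOy => /(_ nOy) /= ->.
Qed.

Lemma field_bounded (M : R) : exists2 A : R, 0 <= A &
  forall u, `|u| <= M -> forall x, Omega x -> `|field u x| <= A.
Proof.
have [B B0 JB] := kernel_bounded bOmega J_cont.
pose Q := c1 * ((vol + 1) * `|M|) + (c2 + `|f 0|) * vol.
have Q0 : 0 <= Q by rewrite addr_ge0// !mulr_ge0// addr_ge0.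
exists (beta * (`|f 0| + B * Q) + beta * h).
  by rewrite addr_ge0// mulr_ge0// addr_ge0// mulr_ge0.
move=> u uM x Ox.
have h1 := conv_le oOmega J_cont JB (iincr u) Ox.
have h2 : \int[lam]_(y in Omega) `|incr u y| <= Q.
  apply: (le_trans (iaff_le (mincr u) (incr_le u))); rewrite lerD2r.
  apply: ler_wpM2l => //; apply: (le_trans (L1_le u)).
  by rewrite ler_wpM2l ?addr_ge0// (le_trans uM)// ler_norm.
apply: (le_trans (ler_normD _ _)); rewrite !normrM (ger0_norm beta_ge0).
rewrite (ger0_norm h_ge0) lerD2r ler_wpM2l//.
apply: (le_trans (ler_normD _ _)); rewrite lerD2l.
by apply: (le_trans h1); exact: ler_wpM2l.
Qed.

Lemma field_equicontinuous (M e : R) : 0 < e -> exists2 d : R, 0 < d &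
  forall u, `|u| <= M -> forall x x', Omega x -> Omega x' -> `|x - x'| < d ->
    `|field u x - field u x'| <= e.
Proof.
move=> e0.
pose Q := c1 * ((vol + 1) * `|M|) + (c2 + `|f 0|) * vol.
have Q0 : 0 <= Q by rewrite addr_ge0// !mulr_ge0// addr_ge0.
have c0 : 0 < beta * Q + 1 by rewrite ltr_wpDl// mulr_ge0.
have [d d0 dP] := kernel_equicontinuous bOmega J_cont (divr_gt0 e0 c0).
exists d => // u uM x x' Ox Ox' xx'.
have h1 := conv_distl oOmega bOmega J_cont (iincr u) Ox Ox'
  (fun y Oy => dP x x' y Ox Ox' Oy xx').
have h2 : \int[lam]_(y in Omega) `|incr u y| <= Q.
  apply: (le_trans (iaff_le (mincr u) (incr_le u))); rewrite lerD2r.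
  apply: ler_wpM2l => //; apply: (le_trans (L1_le u)).
  by rewrite ler_wpM2l ?addr_ge0// (le_trans uM)// ler_norm.
have -> : field u x - field u x' = beta * (conv (incr u) x - conv (incr u) x').
  by rewrite /field; ring.
rewrite normrM (ger0_norm beta_ge0).
have e0' : 0 <= e / (beta * Q + 1) by rewrite divr_ge0// ltW.
apply: (le_trans (ler_wpM2l beta_ge0 (le_trans h1 (ler_wpM2l e0' h2)))).
rewrite mulrCA mulrAC ler_pdivrMr// ler_pM2l//; lra.
Qed.

(** The bound and the modulus of continuity of field u depend only on a bound for
    |u|, and g is uniformly continuous on bounded intervals. *)
Lemma Fmap_compact (M : R) : exists K : set (Lp lam p1),
  [/\ compact K, K `<=` X,
      forall u v, K u -> K v -> forall t : R, 0 <= t <= 1 ->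
        K ((1 - t) *: u + t *: v) &
      forall u, X u -> `|u| <= M -> K (F u)].
Proof.
have [A A0 AP] := field_bounded M.
have /choice[del delP] : forall e : R, exists d : R, 0 < e -> 0 < d /\
    forall u, `|u| <= M -> forall x x', Omega x -> Omega x' -> `|x - x'| < d ->
      `|g (field u x) - g (field u x')| <= e.
  move=> e; have [e0|e0] := ltP 0 e; last by exists 0 => // /lt_geF; rewrite e0.
  have [r r0 rP] := @compact_uniform_continuity R R^o `[- A, A]%classic g
    (@segment_compact _ _ _) (fun x _ => @g_cont x) e e0.
  have r2 : 0 < r / 2 by lra.
  have [d d0 dP] := field_equicontinuous M r2.
  exists d => _; split=> // u uM x x' Ox Ox' xx'.
  apply/ltW/rP; first by rewrite /= in_itv /= -ler_norml AP.
  by apply: (le_lt_trans (dP u uM x x' Ox Ox' xx')); lra.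
pose m := k1 * A + k2.
have m0 : 0 <= m by rewrite addr_ge0// mulr_ge0.
have del0 e : 0 < e -> 0 < del e by move=> /delP[].
exists (@equicontinuous_set R N p p1 Omega m del); split.
- exact: equicontinuous_set_compact.
- exact: equicontinuous_set_sub.
- by move=> u v Ku Kv t t01; exact: equicontinuous_set_convex.
- move=> u Xu uM; rewrite FmapE//; exists (fun x => g (field u x)) => //.
  split=> [x Ox|e e0 x x' Ox Ox' xx'].
    apply: (le_trans (g_growth _)); rewrite lerD2r; apply: ler_wpM2l => //.
    exact: AP.
  by have [_] := delP e e0; apply.
Qed.

Lemma g_field_Lfun u : (fun x => g (field u x)) \_ Omega \in Lfun lam p.
Proof.
have [A A0 AP] := field_bounded `|u|.
apply: (@restrict_Lfun _ _ _ p1 _ oOmega bOmega (k1 * A + k2)).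
  have /(measurable_restrictT _ mOmega) : measurable_fun [set: 'rV[R]_N]
      ((conv (incr u)) \_ Omega).
    have := conv_restrict_Lfun p1 oOmega bOmega J_cont (iincr u).
    by rewrite inE => /andP[/[!inE]].
  move=> mc; apply: (measurableT_comp (continuous_measurable_fun g_cont)).
  apply: measurable_funD => //; apply: measurable_funM => //.
  exact: measurable_funD.
move=> x Ox; apply: (le_trans (g_growth _)); rewrite lerD2r ler_wpM2l//.
exact: AP.
Qed.

(** If theta <= 1 denotes the integral of J x over Omega, the left-hand side is
    conv (f o u) x + f 0 (1 - theta). As |f 0| <= c2, the mass 1 - theta outside
    Omega and the mass theta inside contribute c2 in total. *)
Lemma conv_growth u x : Omega x ->
  `|f 0 + conv (incr u) x| <= c1 * conv (fun y => `|Lp_fun u y|) x + c2.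
Proof.
move=> Ox.
have iw : lam.-integrable Omega (EFin \o (fun y => f (Lp_fun u y))).
  by apply: iaff => [|y]; [exact: measurable_funTS | exact: f_growth].
have i1 : lam.-integrable Omega (EFin \o cst 1).
  exact: integrable_cst_lty.
have iJ := kernelM_integrable oOmega bOmega J_cont.
pose theta := conv (cst 1) x.
have iJw := iJ _ _ iw Ox; have iJ1 := iJ _ _ i1 Ox.
have iJu := iJ _ _ (inu u) Ox.
have -> : conv (incr u) x = conv (fun y => f (Lp_fun u y)) x - f 0 * theta.
  rewrite /theta /conv -RintegralZl// -RintegralB//; last first.
    rewrite (_ : _ \o _ = (fun y => (f 0)%:E * (J x y * cst 1 y)%:E)%E)//.
    exact: integrableZl.
  by apply: eq_Rintegral => y _; rewrite /incr /cst; ring.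
have theta1 : theta <= 1.
  rewrite /theta /conv -lee_fin /Rintegral fineK; last exact: integrable_fin_num.
  rewrite -(J_int_l x) (eq_integral (fun y => (J x y)%:E)); last first.
    by move=> y _; rewrite /= mulr1.
  apply: ge0_subset_integral => //.
  - by apply/measurable_EFinP; exact: kernel_measurable.
  - by move=> y _; rewrite lee_fin.
have cw : `|conv (fun y => f (Lp_fun u y)) x| <=
    c1 * conv (fun y => `|Lp_fun u y|) x + c2 * theta.
  apply: (le_trans (le_normr_Rintegral mOmega iJw)).
  rewrite /theta /conv -RintegralZl// -RintegralZl// -RintegralD//; last 2 first.
  - rewrite (_ : _ \o _ = (fun y => c1%:E * (J x y * `|Lp_fun u y|)%:E)%E)//.
    exact: integrableZl.
  - rewrite (_ : _ \o _ = (fun y => c2%:E * (J x y * cst 1 y)%:E)%E)//.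
    exact: integrableZl.
  apply: le_Rintegral => //.
  - exact: integrable_norm.
  - rewrite (_ : _ \o _ = (fun y => c1%:E * (J x y * `|Lp_fun u y|)%:E +
       c2%:E * (J x y * cst 1 y)%:E)%E)//.
    by apply: integrableD => //; exact: integrableZl.
  - move=> y _; rewrite normrM ger0_norm// /cst.
    by have := ler_wpM2l (J_ge0 x y) (f_growth (Lp_fun u y)); lra.
have f0c : `|f 0| <= c2 by have := f_growth 0; rewrite normr0 mulr0 add0r.
have h1 : `|f 0 * (1 - theta)| <= c2 * (1 - theta).
  by rewrite normrM [`|1 - _|]ger0_norm ?subr_ge0// ler_wpM2r ?subr_ge0.
have -> : f 0 + (conv (fun y => f (Lp_fun u y)) x - f 0 * theta) =
  conv (fun y => f (Lp_fun u y)) x + f 0 * (1 - theta) by ring.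
by apply: (le_trans (ler_normD _ _)); lra.
Qed.

Lemma Fmap_norm_le u : X u ->
  `|F u| <= k1 * beta * c1 * `|u| +
    (k1 * beta * c2 + k1 * beta * h + k2) * vol_root p Omega.
Proof.
move=> Xu; set C := k1 * beta * c2 + k1 * beta * h + k2.
have C0 : 0 <= C by rewrite !addr_ge0// !mulr_ge0.
pose q y := `|Lp_fun u y|.
have Lq := conv_restrict_Lfun p1 oOmega bOmega J_cont (inu u).
pose v : Lp lam p1 := extend0 p1 Omega (conv q).
pose a := k1 * beta * c1.
have a0 : 0 <= a by rewrite !mulr_ge0.
have conv0 x : 0 <= conv q x.
  by apply: Rintegral_ge0 => y _; apply: mulr_ge0 => //; exact: normr_ge0.
apply: (@le_trans _ _ `|a *: v + C *: Lp_indic lam p1 Omega|).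
  rewrite FmapE//; apply: Lp_norm_le.
  have H1 := [elaborate filterI (extend0E p1 (g_field_Lfun u)) (extend0E p1 Lq)].
  have H2 := [elaborate filterI (Lp_funZ a v) (filterI
    (Lp_funZ C (Lp_indic lam p1 Omega)) (Lp_indicE p1 mOmega finOmega))].
  apply: filterS3 H1 H2 (Lp_funD (a *: v) (C *: Lp_indic lam p1 Omega)).
  move=> x [-> // vE] [E1 [E2 E3]] -> //; rewrite E1// E2// E3// vE// indicE /patch.
  case: ifPn => [/set_mem Ox|_]; last by rewrite normr0.
  rewrite mulr1 [leRHS]ger0_norm; last by rewrite addr_ge0// mulr_ge0.
  apply: (le_trans (g_growth _)).
  have h1 : `|field u x| <= beta * (c1 * conv q x + c2) + beta * h.
    apply: (le_trans (ler_normD _ _)); rewrite !normrM (ger0_norm beta_ge0).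
    by rewrite (ger0_norm h_ge0) lerD2r ler_wpM2l// conv_growth.
  by have := ler_wpM2l k1_ge0 h1; rewrite /a /C; lra.
have nZ (b : R) (w : Lp lam p1) : 0 <= b -> `|b *: w| = b * `|w|.
  by move=> b0; rewrite normrZ ger0_norm.
apply: (le_trans (ler_normD _ _)); rewrite (nZ a v a0) (nZ C _ C0).
apply: lerD; apply: ler_wpM2l => //.
  exact: (conv_norm_le oOmega bOmega J_ge0 J_cont J_int_l J_int_r u).
exact: Lp_indic_norm_le.
Qed.

(** The tail of u is made small first; this fixes n, and with it the constant C
    of linear_growth_modulus, after which d can be chosen. *)
Lemma nemytskii_L1_continuous u (e : R) : 0 < e -> exists2 d : R, 0 < d &
  forall v, `|v - u| < d ->
    \int[lam]_(y in Omega) `|f (Lp_fun v y) - f (Lp_fun u y)| <= e.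
Proof.
move=> e0; pose c := 2 * (c1 + c2).
have c0 : 0 <= c by rewrite mulr_ge0// addr_ge0.
have e1 : 0 < e / 3 / (c + 1) by rewrite !divr_gt0// ltr_wpDl.
have [n nP] := integral_tail_small mOmega (iu u) e1.
have e2 : 0 < e / 3 / (vol + 1) by rewrite !divr_gt0// ltr_wpDl.
have [C C0 CP] := linear_growth_modulus n c1_ge0 c2_ge0 f_cont f_growth e2.
pose d := e / 3 / ((C + 1) * (vol + 1)).
have d0 : 0 < d by rewrite !divr_gt0// mulr_gt0// ltr_wpDl.
exists d => // v vu.
have it := integrable_tail mOmega n.+1 (iu u).
have iw1 := ilin (v - u) C (e / 3 / (vol + 1)).
have ict : lam.-integrable Omega (EFin \o (fun y => c * tail n.+1 (Lp_fun u y))).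
  rewrite (_ : _ \o _ = (fun y => c%:E * (tail n.+1 (Lp_fun u y))%:E)%E)//.
  exact: integrableZl.
have ifu v' : lam.-integrable Omega (EFin \o (fun y => f (Lp_fun v' y))).
  by apply: iaff => [|y]; [exact: measurable_funTS | exact: f_growth].
have iff : lam.-integrable Omega
    (EFin \o (fun y => `|f (Lp_fun v y) - f (Lp_fun u y)|)).
  apply: integrable_norm => //.
  rewrite (_ : _ \o _ = (fun y => (f (Lp_fun v y))%:E - (f (Lp_fun u y))%:E)%E)//.
  by apply: integrableB => //; exact: ifu.
have step : \int[lam]_(y in Omega) `|f (Lp_fun v y) - f (Lp_fun u y)| <=
    \int[lam]_(y in Omega) ((C * `|Lp_fun (v - u) y| + e / 3 / (vol + 1)) +
      c * tail n.+1 (Lp_fun u y)).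
  have iw : lam.-integrable Omega (EFin \o (fun y =>
      (C * `|Lp_fun (v - u) y| + e / 3 / (vol + 1)) +
      c * tail n.+1 (Lp_fun u y))).
    rewrite (_ : _ \o _ = (fun y => (C * `|Lp_fun (v - u) y| + e / 3 / (vol + 1))%:E
      + (c * tail n.+1 (Lp_fun u y))%:E)%E)//.
    exact: integrableD.
  rewrite -lee_fin /Rintegral fineK; last exact: integrable_fin_num.
  rewrite fineK; last exact: integrable_fin_num.
  have m1 := measurable_int _ iff; have m2 := measurable_int _ iw.
  apply: ae_ge0_le_integral => //.
  - move=> y _; rewrite lee_fin; apply: addr_ge0; last exact: mulr_ge0 (tail_ge0 _ _).
    by apply: addr_ge0; [exact: mulr_ge0 | exact: ltW].
  - apply: filterS (Lp_funB v u) => y -> // _; rewrite lee_fin.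
    by have := CP (Lp_fun u y) (Lp_fun v y); rewrite /c; lra.
apply: (le_trans step); rewrite RintegralD// linE RintegralZl//.
have h1 : c * \int[lam]_(y in Omega) tail n.+1 (Lp_fun u y) <= e / 3.
  apply: (le_trans (ler_wpM2l c0 nP)).
  by rewrite mulrCA ler_piMr ?divr_ge0 ?ltW// ltr_pdivrMr ?mul1r; lra.
have h2 : e / 3 / (vol + 1) * vol <= e / 3.
  by rewrite mulrAC ler_pdivrMr ?ltr_wpDl// ler_pM2l; lra.
have h3 : C * \int[lam]_(y in Omega) `|Lp_fun (v - u) y| <= e / 3.
  have h4 : \int[lam]_(y in Omega) `|Lp_fun (v - u) y| <= (vol + 1) * d.
    by apply: (le_trans (L1_le _)); rewrite ler_wpM2l ?addr_ge0// ltW.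
  apply: (le_trans (ler_wpM2l C0 h4)).
  have -> : C * ((vol + 1) * d) = e / 3 * (C / (C + 1)).
    by rewrite /d; field; rewrite !gt_eqF// ltr_wpDl.
  rewrite ler_piMr//; first by rewrite ltW//; lra.
  by rewrite ler_pdivrMr ?ltr_wpDl// mul1r lerDl.
lra.
Qed.

Lemma Fmap_continuous u : X u -> forall e : R, 0 < e -> exists2 d : R, 0 < d &
  forall v, X v -> `|v - u| < d -> `|F v - F u| <= e.
Proof.
move=> Xu e e0.
have [B B0 JB] := kernel_bounded bOmega J_cont.
have [A A0 AP] := field_bounded `|u|.
pose c := `|Lp_indic lam p1 Omega| + 1.
have c0 : 0 < c by rewrite ltr_wpDl.
have ec : 0 < e / c by rewrite divr_gt0.
have [r r0 rP] := @compact_uniform_continuity R R^o `[- A, A]%classic g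
  (@segment_compact _ _ _) (fun x _ => @g_cont x) _ ec.
have b0 : 0 < beta * B + 1 by rewrite ltr_wpDl// mulr_ge0.
have r1 : 0 < r / 2 / (beta * B + 1) by rewrite !divr_gt0.
have [d d0 dP] := nemytskii_L1_continuous u r1.
exists d => // v Xv vu; rewrite (FmapE Xv) (FmapE Xu).
apply: (@le_trans _ _ (e / c * `|Lp_indic lam p1 Omega|)); last first.
  by rewrite mulrAC ler_pdivrMr// ler_pM2l// lerDl.
apply: extend0_dist => //; [exact: ltW | exact: g_field_Lfun.. | ].
move=> x Ox; rewrite distrC; apply/ltW/rP.
  by rewrite /= in_itv /= -ler_norml AP.
have -> : field u x - field v x = beta * (conv (incr u) x - conv (incr v) x).
  by rewrite /field; ring.
rewrite normrM (ger0_norm beta_ge0) distrC.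
have h1 := conv_distr oOmega bOmega J_cont JB (iincr v) (iincr u) Ox.
have h2 : \int[lam]_(y in Omega) `|incr v y - incr u y| <=
    r / 2 / (beta * B + 1).
  under eq_Rintegral => y _ do rewrite /incr opprB addrA subrK.
  exact: dP.
have := ler_wpM2l beta_ge0 (le_trans h1 (ler_wpM2l B0 h2)).
move=> /le_lt_trans; apply.
rewrite mulrA mulrCA mulrA ltr_pdivrMr//.
by rewrite mulrC; nra.
Qed.

End field_map.

Lemma locally_lipschitz_continuous (R : realType) (f : R -> R) :
  locally_lipschitz f -> continuous f.
Proof.
move=> fl x; have [U Ux [M0 [_ MP]]] := fl x.
pose M := `|M0| + 1.
have M0M : M0 < M by rewrite (le_lt_trans (ler_norm M0))// ltrDl.
have M1 : 0 < M by rewrite ltr_wpDl.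
apply/cvgrPdist_le => e e0.
have H : nbhs x (ball x (e / M)) by apply: nbhsx_ballx; rewrite divr_gt0.
apply: filterS (filterI Ux H) => y [Uy]; rewrite -ball_normE /= => xy.
have /= := MP M M0M (x, y) (conj (nbhs_singleton Ux) Uy).
move=> /le_trans; apply; rewrite mulrC -ler_pdivlMr//; exact: ltW.
Qed.

Unset Implicit Arguments.
Set Strict Implicit.

Theorem theorem4p3 (R : realType) (N : nat) (N_ge1 : (1 <= N)%N)
  (Omega : set 'rV[R]_N) (Omega_domain : bounded_smooth_domain Omega)
  (beta h : R) (beta_ge0 : 0 <= beta) (h_ge0 : 0 <= h)
  (J : 'rV[R]_N -> 'rV[R]_N -> R)
  (J_ge0 : forall x y, 0 <= J x y)
  (J_sym : forall x y, J x y = J y x)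
  (J_C1 : class_C 1 (fun z : 'rV[R]_N * 'rV[R]_N => J z.1 z.2 : R^o))
  (J_int_l : forall x, (\int[lebesgue_rV R N]_y (J x y)%:E = 1)%E)
  (J_int_r : forall y, (\int[lebesgue_rV R N]_x (J x y)%:E = 1)%E)
  (p : \bar R) (p_ge1 : (1 <= p)%E)
  (f g : R -> R)
  (f_lip : locally_lipschitz f) (g_lip : locally_lipschitz g)
  (k1 k2 c1 c2 : R)
  (k1_ge0 : 0 <= k1) (k2_ge0 : 0 <= k2) (c1_ge0 : 0 <= c1) (c2_ge0 : 0 <= c2)
  (g_growth : forall x, `|g x| <= k1 * `|x| + k2)
  (f_growth : forall x, `|f x| <= c1 * `|x| + c2)
  (k1bc1_lt1 : k1 * beta * c1 < 1)
  (g_derivable : forall x, derivable g x 1) (g'_cont : continuous (derive1 g))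
  (k3 k4 : R) (k3_ge0 : 0 <= k3) (k4_ge0 : 0 <= k4)
  (g'_growth : forall x, `|derive1 g x| <= k3 * `|x| + k4)
  (T : R -> Lp (lebesgue_rV R N) p_ge1 -> Lp (lebesgue_rV R N) p_ge1)
  (T_flow : is_flow (phase_space p_ge1 Omega)
              (fun u => - u + Fmap Omega J f g beta h u) T) :
  exists A : set (Lp (lebesgue_rV R N) p_ge1),
    global_attractor (phase_space p_ge1 Omega) T A /\
    forall sigma : R, 0 < sigma ->
      A `<=` [set u | `|u| <= (1 + sigma) *
                 ((k1 * beta * c2 + k1 * beta * h + k2) * vol_root p Omega
                  / (1 - k1 * beta * c1))].
Proof.
have [_ oOmega _ bOmega _] := Omega_domain.
have J_cont : continuous (fun z : 'rV[R]_N * 'rV[R]_N => J z.1 z.2).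
  by move=> z; apply: differentiable_continuous; exact: J_C1.1.
have f_cont := locally_lipschitz_continuous f_lip.
have g_cont := locally_lipschitz_continuous g_lip.
pose rho := k1 * beta * c1.
pose C := (k1 * beta * c2 + k1 * beta * h + k2) * vol_root p Omega.
have rho_ge0 : 0 <= rho by rewrite !mulr_ge0.
have vol_root_ge0 : 0 <= vol_root p Omega.
  by rewrite /vol_root; case: (p) => // r; exact: powR_ge0.
have C_ge0 : 0 <= C by rewrite mulr_ge0// !addr_ge0// !mulr_ge0.
have F_le := @Fmap_norm_le R N p p_ge1 Omega oOmega bOmega J J_ge0 J_cont J_int_l
  J_int_r _ _ _ _ _ _ _ _ beta_ge0 h_ge0 k1_ge0 k2_ge0 c1_ge0 c2_ge0 f_cont g_cont g_growth f_growth.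
have F_cont := @Fmap_continuous R N p p_ge1 Omega oOmega bOmega J J_ge0 J_cont
  J_int_l _ _ _ _ _ _ _ _ beta_ge0 h_ge0 k1_ge0 c1_ge0 c2_ge0 f_cont g_cont g_growth f_growth.
have F_compact := Fmap_compact p_ge1 oOmega bOmega J_ge0 J_cont J_int_l
  beta_ge0 h_ge0 k1_ge0 k2_ge0 c1_ge0 c2_ge0 f_cont g_cont g_growth f_growth.
exists (trajectory_attractor (phase_space p_ge1 Omega) T); split.
  exact: (trajectory_attractorP rho_ge0 k1bc1_lt1 C_ge0 F_le F_cont F_compact
    T_flow).
move=> sigma sigma0 u Au /=.
apply: (le_trans (trajectory_attractor_norm_le k1bc1_lt1 C_ge0 F_le T_flow Au)).
by rewrite mulrDl mul1r lerDl mulr_ge0 ?(ltW sigma0)// divr_ge0// subr_ge0 ltW.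
Qed.
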